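(* Let $b$ be a connected graph over $X$, let $q:X\to\mathbb{R}$ be a potential, let $H$ be the corresponding Schrödinger operator on $X$, and suppose that $H\ge0$ in $X$. Let $w$ be a positive weight on $X$ (i.e. $w\in C(X)$, $w\ge0$, $w\ne0$). For $\lambda<0$, let $G_\lambda(x,x_0)$ be the positive minimal Green function of the operator $H-\lambda w$ on $X$. Then for each $x,x_0\in X$ we have $$\lim_{\lambda\nearrow0}(-\lambda)G_\lambda(x,x_0)=\phi(x)\phi(x_0),$$ where $\phi=0$ unless $H$ is positive-critical in $X$ with respect to the weight $w$, and in this case $\phi$ is the ground state of $H$ normalized in $\ell^2(X,w)$, that is, $\sum_{x\in X}\phi(x)^2w(x)=1$.
   Context: $X$ is an infinite set with the discrete topology. A graph over $X$ is a symmetric function $b:X\times X\to[0,\infty)$ with zero diagonal such that $\sum_{y\in X}b(x,y)<\infty$ for all $x\in X$; it is connected if any two vertices are joined by a finite path $x_0,\dots,x_n$ with $b(x_i,x_{i+1})>0$. $C(X)$ is the space of real valued functions on $X$ and $C_c(X)$ the subspace of finitely supported functions. Let $F(X)=\{f\in C(X)\mid \sum_{y}b(x,y)|f(y)|<\infty \text{ for all } x\in X\}$, and for $f\in F(X)$ let $Hf(x)=\sum_{y}b(x,y)(f(x)-f(y))+q(x)f(x)$. The associated form on $C_c(X)$ is $h(\varphi)=\frac12\sum_{x,y}b(x,y)(\varphi(x)-\varphi(y))^2+\sum_x q(x)\varphi(x)^2$. $H\ge0$ in $X$ means that there is $u\in F(X)$, $u\ge0$, $u\neq0$, with $Hu\ge0$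 on $X$; this is equivalent to $h\ge0$ on $C_c(X)$. The form $h\ge0$ (or $H$) is subcritical in $X$ if there is $w'\in C(X)$, $w'\ge0$, $w'\ne0$, with $h(\varphi)\ge\sum_xw'(x)\varphi(x)^2$ for all $\varphi\in C_c(X)$; otherwise it is critical. If $H$ is critical, then up to scaling there is a unique $\psi\in F(X)$, $\psi\ge0$, $\psi\ne0$ with $H\psi\ge0$; it is strictly positive and satisfies $H\psi=0$, and is called the ground state. $H$ is positive-critical in $X$ with respect to $w$ if it is critical and $\sum_X\psi^2w<\infty$. For $\lambda<0$ the form $h-\lambda w$, i.e. $\varphi\mapsto h(\varphi)-\lambda\sum_xw(x)\varphi(x)^2$, associated with $H-\lambda w$ is subcritical. It is closable in $\ell^2(X)$ (counting measure); let $A_\lambda$ be the selfadjoint operator associated with its closure. The positive minimal Green function of $H-\lambda w$ is $G_\lambda(x,x_0)=\int_0^\infty e^{-tA_\lambda}1_{\{x_0\}}(x)\,\mathrm{d}t$, which is finite and symmetric; $G_\lambda(\cdot,x_0)$ is the smallest positive solution $g\in F(X)$ of $(H-\lambda w)g\ge1_{\{x_0\}}$, and satisfies $(H-\lambda w)G_\lambda(\cdot,x_0)=1_{\{x_0\}}$. *)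

(* Defs.v *)
From mathcomp Require Import all_boot all_order all_algebra.
From mathcomp Require Import all_classical all_reals all_analysis.
Set Implicit Arguments.
Unset Strict Implicit.
Unset Printing Implicit Defensive.
Import Order.TTheory GRing.Theory Num.Theory.
Import numFieldNormedType.Exports.

Local Open Scope classical_set_scope.
Local Open Scope ring_scope.

(* The value is meaningful for absolutely summable families only; every use
   below is on such families. *)
Definition tsum (R : realType) (T : choiceType) (f : T -> R) : R :=
  fine (\esum_(x in [set: T]) (Num.max (f x) 0)%:E)
  - fine (\esum_(x in [set: T]) (Num.max (- f x) 0)%:E).

Record is_graph (R : realType) (X : choiceType) (b : X -> X -> R) : Prop := {
  graph_sym : forall x y, b x y = b y x;
  graph_diag : forall x, b x x = 0;
  graph_ge0 : forall x y, 0 <= b x y;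
  graph_summable : forall x, summable [set: X] (fun y => (b x y)%:E)
}.

Definition graph_connected (R : realType) (X : choiceType) (b : X -> X -> R) :
    Prop :=
  forall x y : X, exists s : seq X,
    path (fun u v => 0 < b u v) x s /\ last x s = y.

Definition finitely_supported (R : realType) (X : choiceType) (f : X -> R) :
    Prop :=
  finite_set [set x | f x != 0].

Definition formal_domain (R : realType) (X : choiceType) (b : X -> X -> R)
    (f : X -> R) : Prop :=
  forall x, summable [set: X] (fun y => (b x y * `|f y|)%:E).

Definition schrodinger (R : realType) (X : choiceType) (b : X -> X -> R)
    (q : X -> R) (f : X -> R) (x : X) : R :=
  tsum (fun y => b x y * (f x - f y)) + q x * f x.

(* The symmetric bilinear form whose diagonal is h. *)
Definition schrodinger_form (R : realType) (X : choiceType) (b : X -> X -> R)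
    (q : X -> R) (phi psi : X -> R) : R :=
  2^-1 * tsum (fun p : X * X =>
      b p.1 p.2 * (phi p.1 - phi p.2) * (psi p.1 - psi p.2))
  + tsum (fun x => q x * phi x * psi x).

Definition positive_fun (R : realType) (X : choiceType) (f : X -> R) : Prop :=
  (forall x, 0 <= f x) /\ exists x, f x != 0.

Definition positive_supersolution (R : realType) (X : choiceType)
    (b : X -> X -> R) (q : X -> R) (u : X -> R) : Prop :=
  [/\ formal_domain b u, positive_fun u & forall x, 0 <= schrodinger b q u x].

Definition schrodinger_ge0 (R : realType) (X : choiceType) (b : X -> X -> R)
    (q : X -> R) : Prop :=
  exists u : X -> R, positive_supersolution b q u.

Definition subcritical (R : realType) (X : choiceType) (b : X -> X -> R)
    (q : X -> R) : Prop :=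
  exists w' : X -> R, positive_fun w' /\
    forall phi : X -> R, finitely_supported phi ->
      tsum (fun x => w' x * phi x ^+ 2) <= schrodinger_form b q phi phi.

Definition critical (R : realType) (X : choiceType) (b : X -> X -> R)
    (q : X -> R) : Prop :=
  schrodinger_ge0 b q /\ ~ subcritical b q.

(* On a connected graph such a psi is unique up to scaling. *)
Definition ground_state (R : realType) (X : choiceType) (b : X -> X -> R)
    (q : X -> R) (psi : X -> R) : Prop :=
  critical b q /\ positive_supersolution b q psi.

Definition positive_critical (R : realType) (X : choiceType)
    (b : X -> X -> R) (q w : X -> R) : Prop :=
  exists psi : X -> R, ground_state b q psi /\
    (\esum_(x in [set: X]) (psi x ^+ 2 * w x)%:E < +oo)%E.

Definition l2 (R : realType) (X : choiceType) (f : X -> R) : Prop :=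
  summable [set: X] (fun x => (f x ^+ 2)%:E).

Definition l2inner (R : realType) (X : choiceType) (f g : X -> R) : R :=
  tsum (fun x => f x * g x).

Definition l2norm (R : realType) (X : choiceType) (f : X -> R) : R :=
  Num.sqrt (l2inner f f).

(* [a] stands for a symmetric bilinear form with domain the finitely supported
   functions.  [form_approx a phi f]: the sequence phi in C_c(X) converges to f
   in l^2(X) and is Cauchy with respect to a. *)
Definition form_approx (R : realType) (X : choiceType)
    (a : (X -> R) -> (X -> R) -> R) (phi : nat -> X -> R) (f : X -> R) : Prop :=
  [/\ forall n, finitely_supported (phi n),
      l2norm (fun x => phi n x - f x) @[n --> \oo] --> (0 : R)
    & forall e : R, 0 < e -> exists N : nat, forall m n : nat,
        (N <= m)%N -> (N <= n)%N ->
        a (fun x => phi m x - phi n x) (fun x => phi m x - phi n x) < e].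

Definition closure_domain (R : realType) (X : choiceType)
    (a : (X -> R) -> (X -> R) -> R) (f : X -> R) : Prop :=
  l2 f /\ exists phi, form_approx a phi f.

(* Graph of the closure of a: c is the value at (f, v), and it is unique when a
   is closable. *)
Definition form_closure (R : realType) (X : choiceType)
    (a : (X -> R) -> (X -> R) -> R) (f v : X -> R) (c : R) : Prop :=
  exists phi psi : nat -> X -> R,
    [/\ form_approx a phi f, form_approx a psi v
      & a (phi n) (psi n) @[n --> \oo] --> c].

(* Graph of the selfadjoint operator A associated with the closure of a:
   f is in D(A) and A f = g. *)
Definition form_operator (R : realType) (X : choiceType)
    (a : (X -> R) -> (X -> R) -> R) (f g : X -> R) : Prop :=
  [/\ closure_domain a f, l2 g
    & forall v, closure_domain a v -> form_closure a f v (l2inner g v)].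

(* S t = exp(- t A) on l^2(X): the strongly continuous semigroup of bounded
   linear operators with generator - A, where A is given by its graph.  By the
   Hille-Yosida theorem such a semigroup exists and is unique on l^2(X) for
   t >= 0 when A is selfadjoint and bounded below. *)
Record is_semigroup (R : realType) (X : choiceType)
    (A : (X -> R) -> (X -> R) -> Prop) (S : R -> (X -> R) -> X -> R) :
    Prop := {
  semigroup_l2 : forall t f, 0 <= t -> l2 f -> l2 (S t f);
  semigroup_linear : forall t (c : R) f g, 0 <= t -> l2 f -> l2 g ->
    forall x, S t (fun y => c * f y + g y) x = c * S t f x + S t g x;
  semigroup_bounded : forall t, 0 <= t ->
    exists C : R, forall f, l2 f -> l2norm (S t f) <= C * l2norm f;
  semigroup_0 : forall f, l2 f -> forall x, S 0 f x = f x;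
  semigroup_D : forall s t f, 0 <= s -> 0 <= t -> l2 f ->
    forall x, S (s + t) f x = S s (S t f) x;
  semigroup_continuous : forall f, l2 f ->
    l2norm (fun x => S t f x - f x) @[t --> 0^'+] --> (0 : R);
  semigroup_generator : forall f g, l2 f -> l2 g ->
    (A f g <->
     l2norm (fun x => (f x - S t f x) / t - g x) @[t --> 0^'+] --> (0 : R))
}.

(* g x x0 = int_0^oo (exp(- t A) 1_{x0})(x) dt, with A the operator associated
   with the closure of a. *)
Definition is_green (R : realType) (X : choiceType)
    (a : (X -> R) -> (X -> R) -> R) (g : X -> X -> \bar R) : Prop :=
  exists S : R -> (X -> R) -> X -> R,
    is_semigroup (form_operator a) S /\
    forall x x0, g x x0 =
      (\int[lebesgue_measure]_(t in `[0%R, +oo[) (S t \1_[set x0] x)%:E)%E.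

Definition shifted_form (R : realType) (X : choiceType) (b : X -> X -> R)
    (q w : X -> R) (lambda : R) (phi psi : X -> R) : R :=
  schrodinger_form b q phi psi - lambda * tsum (fun x => w x * phi x * psi x).

(* Main.v *)
From HB Require Import structures.
Require Import Defs.
From mathcomp Require Import all_boot all_order all_algebra.
From mathcomp Require Import all_classical all_reals all_analysis.
From mathcomp Require Import measurable_realfun.
From mathcomp Require Import ring lra.
Set Implicit Arguments.
Unset Strict Implicit.
Unset Printing Implicit Defensive.
Import Order.TTheory GRing.Theory Num.Theory.
Import numFieldNormedType.Exports.

Local Open Scope classical_set_scope.
Local Open Scope ring_scope.

(** Write a = h + mu w with mu = - lambda > 0.  The Green function only enters
    through the quadratic quantity

      Q_mu(f) = int_0^oo <exp(- t A) f, f> dt = <A^-1 f, f>,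

    for f in C_c(X): as exp(- t A) is symmetric,
    G(x, x0) = (Q_mu(1_x0 + 1_x) - Q_mu(1_x0 - 1_x)) / 4 by polarisation, and
    <exp(- t A) f, f> = |exp(- t A / 2) f|^2 is nonnegative and nonincreasing
    in t.  The quantity Q_mu(f) is the supremum over phi in C_c(X) of

      2 <f, phi> - h(phi) - mu sum_x w(x) phi(x)^2,

    and from this formula the limit of mu Q_mu(f) can be computed by hand.

    The variational formula.  The semigroup is only known through its
    generator, so the argument works with Riemann sums of
    t |-> <exp(- t A) f, f>.  Uniform boundedness of the semigroup near 0 is an
    instance of the Banach-Steinhaus theorem; after that, symmetry and
    contractivity (semigroup_sym, semigroup_contract), the upper bound
    (riemann_sum_le, with the test vector sum_j tau exp(- j tau A) f, which
    approximates A^-1 f) and the lower bound (riemann_sum_ge, a completed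
    square) are telescoping sums over a grid of step tau.  On the side of the
    form, C_c(X) lies in the domain of A because the columns of b are square
    summable; this gives closability, and the symmetry of A
    (form_closable, form_operator_sym).  The two sides meet in
    green_variational.

    The limit.  Let u > 0 be a supersolution and F = <f, u>.  The ground state
    transform writes h(phi) as a sum of nonnegative edge and vertex terms in
    phi / u, so that along paths |phi(x) / u(x) - phi(y) / u(y)|^2 is bounded by
    C h(phi) (path_bound).  Hence a function whose energy is small compared
    with its size is close to a multiple c u on every finite set, where the
    variational expression is 2 c F - mu c^2 sum_x w(x) u(x)^2, with
    maximum F^2 / (mu sum_x w(x) u(x)^2).  This yields
    limsup mu Q_mu(f) <= F^2 / sum_x w(x) u(x)^2, read as 0 when the sum diverges
    (variational_upper).  If h is subcritical then Q_mu(f) stays bounded and the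
    limit is 0.  If h is critical there are functions 0 <= phi_n <= u in C_c(X)
    with phi_n -> u and h(phi_n) -> 0, and multiples of these show that the upper
    bound is attained (positive_critical_lower).  In the positive-critical case
    the limit is therefore <f, phi>^2 for phi = u normalised in l^2(X, w), and
    polarisation gives phi(x) phi(x0). *)

(** * Unconditional sums *)

Section sums.
Variables (R : realType) (T : choiceType).
Implicit Types (f g : T -> R) (A B : seq T).

(** Convergence along finite sets.  Over R this is equivalent to absolute
    summability ([has_sum_abs_summable], [abs_summable_has_sum]), and linearity
    and reindexing need no splitting into positive and negative parts. *)
Definition has_sum f (s : R) : Prop :=
  forall e : R, 0 < e -> exists A, forall B, uniq B -> {subset A <= B} ->
    `|\sum_(x <- B) f x - s| <= e.

Lemma big_undup_cat A B f :
  \sum_(x <- undup (A ++ B)) f x =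
  \sum_(x <- undup A) f x + \sum_(x <- undup B | x \notin A) f x.
Proof.
rewrite (bigID (mem A)) /=; congr (_ + _); rewrite -big_filter -[RHS]big_filter.
  apply: perm_big; apply: uniq_perm.
  - by rewrite filter_uniq ?undup_uniq.
  - by rewrite filter_uniq ?undup_uniq.
  by move=> x; rewrite !mem_filter !mem_undup mem_cat; case: (x \in A).
apply: perm_big; apply: uniq_perm; rewrite ?filter_uniq ?undup_uniq//.
by move=> x; rewrite !mem_filter !mem_undup mem_cat; case: (x \in A).
Qed.

Lemma has_sum_unique f s t : has_sum f s -> has_sum f t -> s = t.
Proof.
move=> fs ft; apply/eqP; rewrite -subr_eq0 -normr_le0; apply/ler_addgt0Pr => e e0; rewrite add0r.
have e2 : 0 < e / 2 by rewrite divr_gt0.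
have [A hA] := fs _ e2; have [B hB] := ft _ e2.
have := hA (undup (A ++ B)) (undup_uniq _).
have := hB (undup (A ++ B)) (undup_uniq _).
set S := \sum_(x <- _) _.
move=> h1 h2.
have {}h1 : `|S - t| <= e / 2 by apply: h1 => x xB; rewrite mem_undup mem_cat xB orbT.
have {}h2 : `|S - s| <= e / 2 by apply: h2 => x xB; rewrite mem_undup mem_cat xB.
rewrite (_ : s - t = (S - t) - (S - s)); last by ring.
by rewrite (le_trans (ler_normB _ _))// (splitr e) lerD.
Qed.

Lemma has_sumD f g s t : has_sum f s -> has_sum g t ->
  has_sum (fun x => f x + g x) (s + t).
Proof.
move=> fs gt e e0; have e2 : 0 < e / 2 by rewrite divr_gt0.
have [A hA] := fs _ e2; have [B hB] := gt _ e2.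
exists (A ++ B) => D uD sD; rewrite big_split /=.
rewrite opprD addrACA (le_trans (ler_normD _ _))// (splitr e) lerD//.
  by apply: hA => // x xA; apply: sD; rewrite mem_cat xA.
by apply: hB => // x xA; apply: sD; rewrite mem_cat xA orbT.
Qed.

Lemma has_sumZ c f s : has_sum f s -> has_sum (fun x => c * f x) (c * s).
Proof.
move=> fs e e0; have c0 : 0 < `|c| + 1 by rewrite ltr_wpDl.
have [A hA] := fs _ (divr_gt0 e0 c0).
exists A => B uB sB; rewrite -mulr_sumr -mulrBr normrM.
rewrite (@le_trans _ _ ((`|c| + 1) * `|\sum_(x <- B) f x - s|))//.
  by rewrite ler_wpM2r// lerDl.
by rewrite mulrC -ler_pdivlMr// hA.
Qed.

Lemma eq_has_sum f g s : f =1 g -> has_sum f s -> has_sum g s.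
Proof. by move=> /funext ->. Qed.

Lemma has_sum_fin f A : uniq A -> (forall x, x \notin A -> f x = 0) ->
  has_sum f (\sum_(x <- A) f x).
Proof.
move=> uA fA e e0; exists A => B uB sB.
rewrite (_ : \sum_(x <- B) f x = \sum_(x <- A) f x) ?subrr ?normr0 ?ltW//.
rewrite (bigID (mem A)) /= [X in _ + X]big1 => [|x /fA//]; rewrite addr0.
rewrite -big_filter; apply: perm_big; apply: uniq_perm => //.
  by rewrite filter_uniq.
by move=> x; rewrite mem_filter; case xA: (x \in A) => //=; rewrite sB.
Qed.

Lemma has_sum0 : has_sum (fun=> 0) 0.
Proof. by have := @has_sum_fin (fun=> 0) [::]; rewrite big_nil; apply. Qed.

Lemma has_sum_sum (I : Type) (r : seq I) (F : I -> T -> R) (s : I -> R) :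
  (forall i, has_sum (F i) (s i)) ->
  has_sum (fun x => \sum_(i <- r) F i x) (\sum_(i <- r) s i).
Proof.
move=> Fs; elim: r => [|i r IH].
  by rewrite big_nil; apply: eq_has_sum has_sum0 => x; rewrite big_nil.
rewrite big_cons; apply: eq_has_sum (has_sumD (Fs i) IH) => x.
by rewrite big_cons.
Qed.

Lemma has_sum_le f g s t : (forall x, f x <= g x) ->
  has_sum f s -> has_sum g t -> s <= t.
Proof.
move=> fg fs gt; apply/ler_addgt0Pr => e e0.
have e2 : 0 < e / 2 by rewrite divr_gt0.
have [A hA] := fs _ e2; have [B hB] := gt _ e2.
have h1 : `|\sum_(x <- undup (A ++ B)) f x - s| <= e / 2.
  by apply: hA (undup_uniq _) _ => x xA; rewrite mem_undup mem_cat xA.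
have h2 : `|\sum_(x <- undup (A ++ B)) g x - t| <= e / 2.
  by apply: hB (undup_uniq _) _ => x xA; rewrite mem_undup mem_cat xA orbT.
have h3 : \sum_(x <- undup (A ++ B)) f x <= \sum_(x <- undup (A ++ B)) g x.
  by apply: ler_sum.
move: h1 h2; rewrite !ler_norml => /andP[h1 h1'] /andP[h2 h2']; lra.
Qed.

Lemma has_sum_ge_partial f s B : (forall x, 0 <= f x) -> has_sum f s ->
  uniq B -> \sum_(x <- B) f x <= s.
Proof.
move=> f0 fs uB; apply/ler_addgt0Pr => e e0.
have [A hA] := fs _ e0.
have := hA (undup (B ++ A)) (undup_uniq _).
rewrite big_undup_cat (undup_id uB) => h1.
have {h1} : `|\sum_(x <- B) f x + \sum_(x <- undup A | x \notin B) f x - s| <= e.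
  by apply: h1 => x xA; rewrite mem_undup mem_cat xA orbT.
have : 0 <= \sum_(x <- undup A | x \notin B) f x by apply: sumr_ge0.
rewrite ler_norml => h0 /andP[h1 h2]; lra.
Qed.

Lemma has_sum_le_bound f s M : has_sum f s ->
  (forall B, uniq B -> \sum_(x <- B) f x <= M) -> s <= M.
Proof.
move=> fs fM; apply/ler_addgt0Pr => e e0.
have [A hA] := fs _ e0.
have h : `|\sum_(x <- undup A) f x - s| <= e.
  by apply: hA (undup_uniq _) _ => x; rewrite mem_undup.
have := fM _ (undup_uniq A); move: h.
rewrite ler_norml => /andP[h1 h2] h3; lra.
Qed.

Definition abs_summable f := summable [set: T] (fun x => (f x)%:E).

Lemma esum_bound (f : T -> R) M : (forall x, 0 <= f x) ->
  (forall B, uniq B -> \sum_(x <- B) f x <= M) ->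
  (\esum_(x in [set: T]) (f x)%:E <= M%:E)%E.
Proof.
move=> f0 fM; apply: ge_ereal_sup => _ [A [finA _] <-].
move/finite_seqP : finA => [s ->].
rewrite (_ : [set` s] = [set` undup s]); last first.
  by apply/seteqP; split => x /=; rewrite mem_undup.
by rewrite -fsbig_seq ?undup_uniq// sumEFin lee_fin fM// undup_uniq.
Qed.

Lemma esum_ge_partial (f : T -> R) B : (forall x, 0 <= f x) -> uniq B ->
  ((\sum_(x <- B) f x)%:E <= \esum_(x in [set: T]) (f x)%:E)%E.
Proof.
move=> f0 uB; apply: esum_ge; exists [set` B].
  by split => //; exact: finite_seq.
by rewrite -fsbig_seq// sumEFin.
Qed.

Lemma abs_summableP f : abs_summable f <->
  exists M, forall B, uniq B -> \sum_(x <- B) `|f x| <= M.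
Proof.
rewrite /abs_summable /summable; split.
  move=> fS; exists (fine (\esum_(x in [set: T]) `|f x|%:E)%E) => B uB.
  rewrite -lee_fin fineK ?esum_ge_partial//.
  by rewrite ge0_fin_numE// esum_ge0// => x _; rewrite lee_fin.
move=> [M hM]; apply: (@le_lt_trans _ _ M%:E); last exact: ltry.
exact: (@esum_bound (fun x => `|f x|)).
Qed.

Lemma ge0_has_sum f : (forall x, 0 <= f x) ->
  (\esum_(x in [set: T]) (f x)%:E < +oo)%E ->
  has_sum f (fine (\esum_(x in [set: T]) (f x)%:E)%E).
Proof.
move=> f0 foo e e0; set S := (\esum_(x in _) _)%E in foo *.
have Sfin : S \is a fin_num.
  by rewrite ge0_fin_numE// esum_ge0// => x _; rewrite lee_fin.
have [_ [A [finA _] <-] hA] := ub_ereal_sup_adherent e0 Sfin.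
move/finite_seqP : finA hA => [s ->].
rewrite (_ : [set` s] = [set` undup s]); last first.
  by apply/seteqP; split => x /=; rewrite mem_undup.
rewrite -fsbig_seq ?undup_uniq// sumEFin.
have -> : ereal_sup [set (\sum_(x \in A) (f x)%:E)%E | A in fsets [set: T]] = S by [].
rewrite -(fineK Sfin) -EFinB lte_fin => hA.
exists (undup s) => B uB sB.
have h1 := esum_ge_partial f0 uB; rewrite -/S -(fineK Sfin) lee_fin in h1.
have h2 : \sum_(x <- undup s) f x <= \sum_(x <- B) f x.
  have pe : perm_eq [seq x <- B | x \in undup s] (undup s).
    apply: uniq_perm; rewrite ?filter_uniq ?undup_uniq// => x.
    by rewrite mem_filter /=; case xA: (x \in undup s) => //=; rewrite sB.
  rewrite -(perm_big _ pe) big_filter [leRHS](bigID (mem (undup s))) /=.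
  by rewrite lerDl sumr_ge0.
rewrite ler_norml; apply/andP; split; lra.
Qed.

Lemma has_sum_esum (f : T -> R) (s : R) : (forall x, 0 <= f x) ->
  has_sum f s -> (\esum_(x in [set: T]) (f x)%:E = s%:E)%E.
Proof.
move=> f0 fs.
have foo : (\esum_(x in [set: T]) (f x)%:E < +oo)%E.
  apply: (@le_lt_trans _ _ s%:E); last exact: ltry.
  by apply: esum_bound => // B uB; exact: has_sum_ge_partial fs uB.
rewrite -(has_sum_unique (ge0_has_sum f0 foo) fs) fineK//.
by rewrite ge0_fin_numE// esum_ge0// => x _; rewrite lee_fin.
Qed.

Lemma abs_summable_has_sum f : abs_summable f -> has_sum f (tsum f).
Proof.
move=> /abs_summableP[M hM].
have hp (h : T -> R) : (forall x, 0 <= h x) -> (forall x, h x <= `|f x|) ->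
    has_sum h (fine (\esum_(x in [set: T]) (h x)%:E)%E).
  move=> h0 hf; apply: ge0_has_sum => //.
  apply: (@le_lt_trans _ _ M%:E); last exact: ltry.
  apply: esum_bound => // B uB; apply: le_trans (hM _ uB).
  by apply: ler_sum.
have := has_sumD (hp (fun x => Num.max (f x) 0) _ _)
  (has_sumZ (-1) (hp (fun x => Num.max (- f x) 0) _ _)).
rewrite mulN1r; set P := has_sum _ _; suff -> : P = has_sum f (tsum f).
  apply=> x; rewrite ?le_max ?lexx ?orbT// ge_max normr_ge0 andbT ?ler_norm//.
  by rewrite ler_normr lexx orbT.
rewrite /P; congr has_sum; apply/funext => x.
by case: (leP (f x) 0) => h; case: (leP (- f x) 0) => h'; lra.
Qed.

(** Finite sets that avoid A have sums of modulus at most 2; splitting such a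
    set by the sign of f bounds the sums of absolute values. *)
Lemma has_sum_abs_summable f s : has_sum f s -> abs_summable f.
Proof.
move=> fs; apply/abs_summableP; have [A hA] := fs _ ltr01.
have key B (P : pred T) : uniq B -> (forall x, P x -> x \notin A) ->
    `|\sum_(x <- B | P x) f x| <= 2.
  move=> uB PA.
  have h1 : `|\sum_(x <- undup A) f x - s| <= 1.
    by apply: hA (undup_uniq _) _ => x; rewrite mem_undup.
  have := hA (undup (A ++ seq.filter P B)) (undup_uniq _).
  rewrite big_undup_cat (undup_id (filter_uniq P uB)) big_filter_cond => h2.
  have {}h2 : `|\sum_(x <- undup A) f x +
                \sum_(x <- B | P x && (x \notin A)) f x - s| <= 1.
    by apply: h2 => x xA; rewrite mem_undup mem_cat xA.
  rewrite [X in _ + X - _](eq_bigl P) in h2; last first.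
    by move=> x; apply: andb_idr => /PA.
  rewrite (_ : \sum_(x <- B | P x) f x =
    (\sum_(x <- undup A) f x + \sum_(x <- B | P x) f x - s) -
    (\sum_(x <- undup A) f x - s)); last by ring.
  by rewrite (le_trans (ler_normB _ _))// lerD.
exists (\sum_(x <- undup A) `|f x| + 4) => B uB.
rewrite (bigID (mem A)) /= lerD//.
  rewrite -big_filter.
  rewrite [leRHS](bigID (mem B)) /= -[X in _ <= X + _]big_filter.
  rewrite (perm_big [seq x <- undup A | x \in B]) ?lerDl ?sumr_ge0//.
  apply: uniq_perm; rewrite ?filter_uniq ?undup_uniq//.
  by move=> x; rewrite !mem_filter /= mem_undup andbC.
rewrite (bigID (fun x => 0 <= f x)) /= (_ : 4 = 2 + 2); last by ring.
rewrite lerD//.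
  rewrite (eq_bigr f) => [|x /andP[_ /ger0_norm//]].
  by rewrite (le_trans (ler_norm _))// key// => x /andP[].
rewrite (eq_bigr (fun x => - f x)) => [|x /andP[_]]; last first.
  by rewrite -ltNge => /ltr0_norm.
rewrite sumrN (le_trans (ler_norm _))// normrN key// => x /andP[]//.
Qed.

Lemma has_sum_tsum f s : has_sum f s -> tsum f = s.
Proof.
move=> fs; apply: (has_sum_unique _ fs).
exact/abs_summable_has_sum/has_sum_abs_summable/fs.
Qed.

Lemma abs_summable_dom f g : (forall x, `|f x| <= `|g x|) ->
  abs_summable g -> abs_summable f.
Proof.
move=> fg /abs_summableP[M hM]; apply/abs_summableP; exists M => B uB.
by apply: le_trans (hM _ uB); apply: ler_sum.
Qed.

End sums.

(** * Square-summable functions as a complete normed space *)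

(** The source of the Cauchy-Schwarz inequality, both for the inner product of
    l^2 and for the form. *)
Lemma discriminant_le (R : realType) (a b c : R) : 0 <= c ->
  (forall t : R, 0 <= a + 2 * t * b + t ^+ 2 * c) -> b ^+ 2 <= a * c.
Proof.
rewrite le_eqVlt => /predU1P[<-|c0] h.
  have [->|b0] := eqVneq b 0; first by rewrite expr0n mulr0.
  have := h (- (a + 1) / b / 2).
  have -> : a + 2 * (- (a + 1) / b / 2) * b + (- (a + 1) / b / 2) ^+ 2 * 0 = -1.
    by field.
  by rewrite oppr_ge0 ler10.
have := h (- b / c).
have -> : a + 2 * (- b / c) * b + (- b / c) ^+ 2 * c = (a * c - b ^+ 2) / c.
  by field; rewrite gt_eqF.
by rewrite pmulr_lge0 ?invr_gt0// subr_ge0.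
Qed.

Section ell2_functions.
Variables (R : realType) (X : choiceType).
Implicit Types (f g h : X -> R).

Lemma l2P f : l2 f <-> abs_summable (fun x => f x ^+ 2).
Proof. by []. Qed.

Lemma l2_inner_summable f g : l2 f -> l2 g -> abs_summable (fun x => f x * g x).
Proof.
move=> lf lg.
have s := has_sumD (abs_summable_has_sum lf) (abs_summable_has_sum lg).
apply: abs_summable_dom (has_sum_abs_summable s) => x.
rewrite [leRHS]ger0_norm ?addr_ge0 -?expr2 ?sqr_ge0//.
rewrite ler_norml; apply/andP; split; nra.
Qed.

Lemma l2_has_sum f g : l2 f -> l2 g ->
  has_sum (fun x => f x * g x) (l2inner f g).
Proof. by move=> lf lg; exact/abs_summable_has_sum/l2_inner_summable. Qed.

Lemma l2_lin c f g : l2 f -> l2 g -> l2 (fun x => c * f x + g x).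
Proof.
move=> lf lg; apply/l2P.
have s := has_sumD (has_sumZ (c ^+ 2) (l2_has_sum lf lf))
  (has_sumD (has_sumZ (2 * c) (l2_has_sum lf lg)) (l2_has_sum lg lg)).
by apply: has_sum_abs_summable; apply: eq_has_sum s => x; ring.
Qed.

Lemma l20 : l2 (fun _ : X => 0 : R).
Proof.
apply/l2P; apply: (has_sum_abs_summable (s := 0)).
by apply: eq_has_sum (@has_sum0 R X) => x; rewrite expr0n.
Qed.

Lemma l2Z c f : l2 f -> l2 (fun x => c * f x).
Proof.
move=> lf; have := l2_lin c lf l20; congr l2; apply/funext => x.
by rewrite addr0.
Qed.

Lemma l2D f g : l2 f -> l2 g -> l2 (fun x => f x + g x).
Proof.
move=> lf lg; have := l2_lin 1 lf lg; congr l2; apply/funext => x.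
by rewrite mul1r.
Qed.

Lemma l2B f g : l2 f -> l2 g -> l2 (fun x => f x - g x).
Proof.
move=> lf lg; have := l2_lin (-1) lg lf; congr l2; apply/funext => x.
by rewrite mulN1r addrC.
Qed.

Lemma l2inner_linl c f g h : l2 f -> l2 g -> l2 h ->
  l2inner (fun x => c * f x + g x) h = c * l2inner f h + l2inner g h.
Proof.
move=> lf lg lh; apply: has_sum_tsum.
apply: eq_has_sum (has_sumD (has_sumZ c (l2_has_sum lf lh)) (l2_has_sum lg lh)).
by move=> x; ring.
Qed.

Lemma l2innerC f g : l2inner f g = l2inner g f.
Proof. by rewrite /l2inner; congr tsum; apply/funext => x; rewrite mulrC. Qed.

Lemma l2innerBr f g h : l2 f -> l2 g -> l2 h ->
  l2inner h (fun x => f x - g x) = l2inner h f - l2inner h g.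
Proof.
move=> lf lg lh; rewrite -mulN1r; apply: has_sum_tsum.
apply: eq_has_sum (has_sumD (l2_has_sum lh lf) (has_sumZ (-1) (l2_has_sum lh lg))).
by move=> x; ring.
Qed.

Lemma l2inner_ge0 f : l2 f -> 0 <= l2inner f f.
Proof.
move=> lf; apply: has_sum_le (@has_sum0 R X) (l2_has_sum lf lf) => x.
by rewrite -expr2 sqr_ge0.
Qed.

Lemma l2norm_sqr f : l2 f -> l2norm f ^+ 2 = l2inner f f.
Proof. by move=> lf; rewrite sqr_sqrtr// l2inner_ge0. Qed.

Lemma l2_partial f B : l2 f -> uniq B -> \sum_(x <- B) f x ^+ 2 <= l2norm f ^+ 2.
Proof.
move=> lf uB; rewrite l2norm_sqr//.
have := l2_has_sum lf lf => /has_sum_ge_partial; apply => //.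
by move=> x; rewrite -expr2 sqr_ge0.
Qed.

Lemma l2_le f x : l2 f -> `|f x| <= l2norm f.
Proof.
move=> lf; rewrite -(@ler_pXn2r _ 2) ?nnegrE ?sqrtr_ge0//.
by have := @l2_partial f [:: x] lf isT; rewrite big_seq1 real_normK ?num_real.
Qed.

Lemma l2_bounded f (M : R) : 0 <= M ->
  (forall B, uniq B -> \sum_(x <- B) f x ^+ 2 <= M ^+ 2) ->
  l2 f /\ l2norm f <= M.
Proof.
move=> M0 hM.
have lf : l2 f.
  apply/l2P/abs_summableP; exists (M ^+ 2) => B /hM.
  by under eq_bigr => x _ do rewrite -[_ ^+ 2]ger0_norm ?sqr_ge0//.
split => //; rewrite -(@ler_pXn2r _ 2) ?nnegrE ?sqrtr_ge0// l2norm_sqr//.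
by apply: has_sum_le_bound (l2_has_sum lf lf) _ => B /hM.
Qed.

Lemma l2inner_abs_le f g : l2 f -> l2 g ->
  `|l2inner f g| <= l2norm f * l2norm g.
Proof.
move=> lf lg; rewrite -(@ler_pXn2r _ 2) ?nnegrE ?mulr_ge0 ?sqrtr_ge0//.
rewrite real_normK ?num_real// exprMn !l2norm_sqr//.
apply: discriminant_le => [|t]; first exact: l2inner_ge0.
have lt := l2_lin t lg lf.
rewrite (_ : _ + _ = l2inner (fun x => t * g x + f x) (fun x => t * g x + f x)).
  exact: l2inner_ge0.
apply/esym/has_sum_tsum; apply: eq_has_sum (has_sumD (has_sumD (l2_has_sum lf lf)
  (has_sumZ (2 * t) (l2_has_sum lf lg))) (has_sumZ (t ^+ 2) (l2_has_sum lg lg))).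
by move=> x; ring.
Qed.

Lemma l2normD f g : l2 f -> l2 g ->
  l2norm (fun x => f x + g x) <= l2norm f + l2norm g.
Proof.
move=> lf lg; have lfg := l2D lf lg.
rewrite -(@ler_pXn2r _ 2) ?nnegrE ?addr_ge0 ?sqrtr_ge0//.
rewrite l2norm_sqr//.
have e : l2inner (fun x => f x + g x) (fun x => f x + g x) =
    l2inner f f + 2 * l2inner f g + l2inner g g.
  apply: has_sum_tsum; apply: eq_has_sum (has_sumD (has_sumD (l2_has_sum lf lf)
    (has_sumZ 2 (l2_has_sum lf lg))) (l2_has_sum lg lg)) => x; ring.
rewrite e -!l2norm_sqr//.
have := l2inner_abs_le lf lg; rewrite ler_norml => /andP[_ h]; nra.
Qed.

Lemma l2normZ c f : l2 f -> l2norm (fun x => c * f x) = `|c| * l2norm f.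
Proof.
move=> lf; rewrite /l2norm -sqrtr_sqr -sqrtrM ?sqr_ge0//; congr Num.sqrt.
apply: has_sum_tsum; apply: eq_has_sum (has_sumZ (c ^+ 2) (l2_has_sum lf lf)).
by move=> x; ring.
Qed.

End ell2_functions.

(** Packaging l^2 as a type lets it carry a structure of complete normed module,
    as the Banach-Steinhaus theorem requires. *)
Record ell2 (R : realType) (X : choiceType) : Type :=
  Ell2 { ell2_fun :> X -> R; ell2P : l2 ell2_fun }.

Section ell2_space.
Variables (R : realType) (X : choiceType).
Local Notation E := (ell2 R X).

Lemma ell2_ext (f g : E) : f =1 g -> f = g.
Proof.
case: f g => [f lf] [g lg] /= /funext fg; subst g.
by congr Ell2; exact: Prop_irrelevance.
Qed.

HB.instance Definition _ := gen_eqMixin E.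
HB.instance Definition _ := gen_choiceMixin E.

Definition ell2_zero : E := Ell2 (@l20 R X).
Definition ell2_add (f g : E) : E := Ell2 (l2D (ell2P f) (ell2P g)).
Definition ell2_scale (c : R) (f : E) : E := Ell2 (l2Z c (ell2P f)).
Definition ell2_opp (f : E) : E := ell2_scale (-1) f.

Lemma ell2_addA : associative ell2_add.
Proof. by move=> f g h; apply: ell2_ext => x /=; rewrite addrA. Qed.
Lemma ell2_addC : commutative ell2_add.
Proof. by move=> f g; apply: ell2_ext => x /=; rewrite addrC. Qed.
Lemma ell2_add0 : left_id ell2_zero ell2_add.
Proof. by move=> f; apply: ell2_ext => x /=; rewrite add0r. Qed.
Lemma ell2_addN : left_inverse ell2_zero ell2_opp ell2_add.
Proof. by move=> f; apply: ell2_ext => x /=; rewrite mulN1r addNr. Qed.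
HB.instance Definition _ :=
  GRing.isZmodule.Build E ell2_addA ell2_addC ell2_add0 ell2_addN.

Lemma ell2_scaleA (a b : R) (f : E) :
  ell2_scale a (ell2_scale b f) = ell2_scale (a * b) f.
Proof. by apply: ell2_ext => x /=; rewrite mulrA. Qed.
Lemma ell2_scale1 : left_id 1 ell2_scale.
Proof. by move=> f; apply: ell2_ext => x /=; rewrite mul1r. Qed.
Lemma ell2_scaleDr : right_distributive ell2_scale +%R.
Proof. by move=> c f g; apply: ell2_ext => x /=; rewrite mulrDr. Qed.
Lemma ell2_scaleDl (f : E) : {morph ell2_scale^~ f : a b / a + b}.
Proof. by move=> a b; apply: ell2_ext => x /=; rewrite mulrDl. Qed.
HB.instance Definition _ := GRing.Zmodule_isLmodule.Build R E
  ell2_scaleA ell2_scale1 ell2_scaleDr ell2_scaleDl.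

Lemma ell2DE (f g : E) x : (f + g) x = f x + g x. Proof. by []. Qed.
Lemma ell2ZE c (f : E) x : (c *: f) x = c * f x. Proof. by []. Qed.
Lemma ell2NE (f : E) x : (- f) x = - f x.
Proof. by rewrite -[RHS]mulN1r. Qed.
Lemma ell2BE (f g : E) x : (f - g) x = f x - g x.
Proof. by rewrite ell2DE ell2NE. Qed.

Definition ell2_norm (f : E) : R := l2norm f.
Lemma ell2_normD (f g : E) : ell2_norm (f + g) <= ell2_norm f + ell2_norm g.
Proof. exact: l2normD (ell2P f) (ell2P g). Qed.
Lemma ell2_normZ (c : R) (f : E) : ell2_norm (c *: f) = `|c| * ell2_norm f.
Proof. exact: l2normZ (ell2P f). Qed.
Lemma ell2_norm_eq0 (f : E) : ell2_norm f = 0 -> f = 0.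
Proof.
move=> f0; apply: ell2_ext => x; apply/eqP; rewrite -normr_le0.
by rewrite -f0 l2_le//; exact: ell2P.
Qed.
HB.instance Definition _ :=
  Lmodule_isNormed.Build R E ell2_normD ell2_normZ ell2_norm_eq0.

Lemma ell2_normE (f : E) : `|f| = l2norm f. Proof. by []. Qed.

(** Point evaluations are contractions, so a Cauchy filter converges pointwise;
    bounds on finite sums of squares pass to the pointwise limit. *)
Lemma ell2_complete (F : set_system E) : ProperFilter F -> cauchy F -> cvg F.
Proof.
move=> PF /cauchyP Fc.
have Fx x : cvg ((fun f : E => f x) @ F).
  apply: cauchy_cvg; apply: cauchy_exP => e e0.
  have [f0 hf0] := Fc _ e0; exists (f0 x).
  suff : F [set f : E | ball (f0 x) e (f x)] by [].
  apply: filterS hf0 => f; rewrite -!ball_normE /= => h.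
  by apply: le_lt_trans h; have := l2_le x (ell2P (f0 - f)); rewrite ell2BE.
pose g x := lim ((fun f : E => f x) @ F).
have gap e : 0 < e -> exists f0 : E, F (ball f0 e) /\
    forall B, uniq B -> \sum_(x <- B) (f0 x - g x) ^+ 2 <= e ^+ 2.
  move=> e0; have [f0 hf0] := Fc _ e0; exists f0; split => // B uB.
  have cv : (fun f : E => \sum_(x <- B) (f0 x - f x) ^+ 2) @ F -->
      \sum_(x <- B) (f0 x - g x) ^+ 2.
    elim: B {uB} => [|x B IH].
      under eq_fun do rewrite big_nil.
      by rewrite big_nil; exact: cvg_cst.
    under eq_fun do rewrite big_cons expr2.
    rewrite big_cons expr2; apply: cvgD => //.
    have c1 : (fun f : E => f0 x - f x) @ F --> f0 x - g x.
      by apply: cvgB; [exact: cvg_cst|exact: Fx].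
    exact: cvgM.
  apply: (cvgr_to_le cv); apply: filterS hf0 => f; rewrite -ball_normE /= => h.
  have := l2_partial (ell2P ((f0 : E) - (f : E))) uB.
  rewrite (eq_bigr (fun x => (f0 x - f x) ^+ 2)) => [|x _]; last by rewrite ell2BE.
  by move=> /le_trans; apply; rewrite -ell2_normE ler_pXn2r ?nnegrE// ltW.
have lg : l2 g.
  have [f0 [_ h]] := gap _ ltr01.
  have [l _] := l2_bounded ler01 h.
  have := l2B (ell2P f0) l; congr l2; apply/funext => x.
  by rewrite opprB addrC subrK.
apply/cvg_ex; exists (Ell2 lg); apply/cvgrPdist_le => e e0.
have e2 : 0 < e / 2 by rewrite divr_gt0.
have [f0 [F0 h]] := gap _ e2.
have [_ n] := l2_bounded (ltW e2) h.
apply: filterS F0 => f; rewrite -ball_normE /= => hf.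
rewrite (_ : Ell2 lg - f = (f0 - f) - (f0 - Ell2 lg)); last first.
  by rewrite opprB [RHS]addrC addrA subrK.
rewrite (le_trans (ler_normB _ _))// (splitr e) lerD ?(ltW hf)//.
rewrite ell2_normE (_ : ell2_fun _ = fun x => f0 x - g x)//.
by apply/funext => x; rewrite ell2BE.
Qed.
HB.instance Definition _ := Uniform_isComplete.Build E ell2_complete.

Definition ell2_ip (f g : E) : R := l2inner f g.
Lemma ell2_ipC f g : ell2_ip f g = ell2_ip g f. Proof. exact: l2innerC. Qed.
Lemma ell2_ip_linl c f g h : ell2_ip (c *: f + g) h = c * ell2_ip f h + ell2_ip g h.
Proof. exact: l2inner_linl (ell2P f) (ell2P g) (ell2P h). Qed.
Lemma ell2_ip_norm f : ell2_ip f f = `|f| ^+ 2.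
Proof. by rewrite ell2_normE l2norm_sqr//; exact: ell2P. Qed.

End ell2_space.

(** * Riemann sums of nonincreasing functions *)

Section monotone_integral.
Variables (R : realType) (m : R -> R).
Hypothesis m_noninc : nonincreasing_fun m.
Hypothesis m_ge0 : forall t, 0 <= m t.
Local Notation mu := (@lebesgue_measure R).

Lemma monotone_measurable (D : set R) : measurable D ->
  measurable_fun D (EFin \o m).
Proof. by move=> mD; apply/measurable_EFinP; exact: nonincreasing_measurable. Qed.

Lemma integral_cell_bounds (s t : R) : s <= t ->
  (((t - s) * m t)%:E <= \int[mu]_(x in `[s, t[) (m x)%:E <= ((t - s) * m s)%:E)%E.
Proof.
move=> st.
have cell (c : R) : (\int[mu]_(x in `[s, t[) (cst c%:E x) = ((t - s) * c)%:E)%E.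
  rewrite integral_cst//= lebesgue_measure_itv/= lte_fin.
  case: ltP => [_|ts]; first by rewrite -EFinB -EFinM mulrC.
  have -> : t = s by apply/le_anti; rewrite st ts.
  by rewrite subrr mul0r mule0.
rewrite -!cell; apply/andP; split; apply: ge0_le_integral => //=.
- by move=> x _; rewrite lee_fin.
- exact: monotone_measurable.
- by move=> x; rewrite in_itv/= => /andP[_ /ltW xt]; rewrite lee_fin m_noninc.
- by move=> x _; rewrite lee_fin.
- exact: monotone_measurable.
- by move=> x; rewrite in_itv/= => /andP[xs _]; rewrite lee_fin m_noninc.
Qed.

(** On each cell of the grid the integrand lies between its two end values. *)
Lemma integral_riemann_bounds (tau : R) (n : nat) : 0 <= tau ->
  ((tau * \sum_(j < n) m (j.+1%:R * tau))%:E
   <= \int[mu]_(x in `[0%R, (n%:R * tau)%R[) (m x)%:E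
   <= (tau * \sum_(j < n) m (j%:R * tau))%:E)%E.
Proof.
move=> tau0; elim: n => [|n /andP[IHl IHr]].
  rewrite !big_ord0 mulr0 mul0r set_itv_ge ?bnd_simp ?lexx// ?ltxx//.
  by rewrite integral_set0 lexx.
have nt : n%:R * tau <= n.+1%:R * tau by rewrite ler_wpM2r// ler_nat.
have n0 : 0 <= n%:R * tau by rewrite mulr_ge0.
have -> : `[0%R, n.+1%:R * tau[%classic =
    `[0%R, n%:R * tau[%classic `|` `[n%:R * tau, n.+1%:R * tau[%classic.
  by rewrite -itv_bndbnd_setU// bnd_simp.
rewrite ge0_integral_setU//=; last 3 first.
- exact: monotone_measurable (measurableU _ _ _ _).
- by move=> x _; rewrite lee_fin.
- rewrite disj_set2E; apply/eqP/seteqP; split => // x /=.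
  by rewrite !in_itv/= => -[/andP[_ h1] /andP[h2 _]]; move: (lt_le_trans h1 h2); rewrite ltxx.
have /andP[h1 h2] := integral_cell_bounds nt.
have tE : n.+1%:R * tau - n%:R * tau = tau by rewrite -mulrBl -natrB// subSnn mul1r.
rewrite tE in h1 h2.
rewrite !big_ord_recr /= !mulrDr !EFinD.
by apply/andP; split; apply: leeD.
Qed.

Lemma integral_halfline_ge (tau : R) (n : nat) : 0 <= tau ->
  ((tau * \sum_(j < n) m (j%:R * tau))%:E - (tau * m 0%R)%:E
   <= \int[mu]_(x in `[0%R, +oo[) (m x)%:E)%E.
Proof.
move=> tau0; have /andP[h _] := integral_riemann_bounds n tau0.
apply: (@le_trans _ _ (tau * \sum_(j < n) m (j.+1%:R * tau))%:E).
  rewrite -EFinB lee_fin lerBlDl -mulrDr ler_wpM2l//.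
  case: n {h} => [|n]; first by rewrite !big_ord0 addr0.
  rewrite big_ord_recl mul0r lerD2l /= big_ord_recr /=.
  by rewrite ler_wpDr.
apply: (le_trans h); apply: ge0_subset_integral => //=.
- exact: monotone_measurable.
- by move=> x _; rewrite lee_fin.
- by move=> x /=; rewrite !in_itv/= => /andP[->].
Qed.

Lemma integral_halfline_le (M : R) :
  (forall T e : R, 0 < T -> 0 < e -> exists n, T / n.+1%:R *
     \sum_(j < n.+1) m (j%:R * (T / n.+1%:R)) <= M + e) ->
  (\int[mu]_(x in `[0%R, +oo[) (m x)%:E <= M%:E)%E.
Proof.
move=> hM.
have itvE : `[0%R, +oo[%classic = \bigcup_(i : nat) `[0%R, (i%:R : R)[%classic.
  apply/seteqP; split => x /=; rewrite in_itv/= ?andbT.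
    move=> x0; exists (Num.truncn x).+1 => //=; rewrite in_itv/= x0/=.
    exact: Num.Theory.truncnS_gt.
  by move=> [i _] /=; rewrite in_itv/= => /andP[].
rewrite itvE.
pose F (i : nat) := `[0%R, (i%:R : R)[%classic.
have ndF : nondecreasing_seq F.
  move=> i j ij; rewrite subsetEset => x; rewrite /F /= !in_itv/= => /andP[-> xi].
  by rewrite (lt_le_trans xi)// ler_nat.
have mF i : measurable (F i) by exact: measurable_itv.
have mfF i : measurable_fun (F i) (EFin \o m) by exact: monotone_measurable.
have f0F i x : F i x -> (0 <= (EFin \o m) x)%E by rewrite lee_fin.
have cv := @ge0_nondecreasing_set_cvg_integral _ _ _ _ _ (@lebesgue_measure R) ndF mF mfF f0F.
rewrite -(cvg_lim _ cv)//; apply: lime_le; first by apply/cvg_ex; eexists; exact: cv.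
apply: nearW => i; apply/lee_addgt0Pr => e e0.
case: i => [|i].
  rewrite /F set_itv_ge ?bnd_simp ?ltxx// integral_set0 lee_fin.
  have [n hn] := hM 1 e ltr01 e0; apply: le_trans hn.
  by rewrite mulr_ge0// ?sumr_ge0//.
have [n hn] := hM i.+1%:R e (ltr0Sn _ _) e0.
have /andP[_] := integral_riemann_bounds n.+1 (divr_ge0 (ler0n R i.+1) (ler0n R n.+1)).
rewrite (mulrC n.+1%:R) divfK ?pnatr_eq0// => /le_trans; apply.
by rewrite -EFinD lee_fin.
Qed.

End monotone_integral.

(** * Symmetric semigroups on a Hilbert space *)

Section hilbert.
Variables (R : realType) (E : completeNormedModType R) (ip : E -> E -> R).
Hypothesis ipC : forall x y, ip x y = ip y x.
Hypothesis ip_linl : forall c x y z, ip (c *: x + y) z = c * ip x z + ip y z.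
Hypothesis ip_norm : forall x, ip x x = `|x| ^+ 2.

Lemma ip0l z : ip 0 z = 0.
Proof. by have := ip_linl (-1) 0 0 z; rewrite scaler0 addr0 mulN1r addNr. Qed.
Lemma ipDl x y z : ip (x + y) z = ip x z + ip y z.
Proof. by rewrite -[x]scale1r ip_linl mul1r scale1r. Qed.
Lemma ipZl c x z : ip (c *: x) z = c * ip x z.
Proof. by rewrite -[c *: x]addr0 ip_linl ip0l addr0. Qed.
Lemma ipNl x z : ip (- x) z = - ip x z.
Proof. by rewrite -scaleN1r ipZl mulN1r. Qed.
Lemma ipBl x y z : ip (x - y) z = ip x z - ip y z.
Proof. by rewrite ipDl ipNl. Qed.
Lemma ip0r z : ip z 0 = 0. Proof. by rewrite ipC ip0l. Qed.
Lemma ipDr x y z : ip z (x + y) = ip z x + ip z y.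
Proof. by rewrite ipC ipDl !(ipC z). Qed.
Lemma ipZr c x z : ip z (c *: x) = c * ip z x.
Proof. by rewrite ipC ipZl (ipC z). Qed.
Lemma ipBr x y z : ip z (x - y) = ip z x - ip z y.
Proof. by rewrite ipC ipBl !(ipC z). Qed.
Lemma ip_suml (I : Type) (r : seq I) (F : I -> E) z :
  ip (\sum_(j <- r) F j) z = \sum_(j <- r) ip (F j) z.
Proof.
by elim: r => [|j r IH]; rewrite ?big_nil ?ip0l// !big_cons ipDl IH.
Qed.
Lemma ip_sumr (I : Type) (r : seq I) (F : I -> E) z :
  ip z (\sum_(j <- r) F j) = \sum_(j <- r) ip z (F j).
Proof. by rewrite ipC ip_suml; apply: eq_bigr => j _; rewrite ipC. Qed.

Lemma ip_le x y : ip x y <= `|x| * `|y|.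
Proof.
have [->|x0] := eqVneq x 0; first by rewrite ip0l normr0 mul0r.
have [->|y0] := eqVneq y 0; first by rewrite ip0r normr0 mulr0.
have nx : 0 < `|x| by rewrite normr_gt0.
have ny : 0 < `|y| by rewrite normr_gt0.
have : 0 <= ip (`|y| *: x - `|x| *: y) (`|y| *: x - `|x| *: y).
  by rewrite ip_norm sqr_ge0.
rewrite ipBl !ipBr !ipZl !ipZr !ip_norm (ipC y x) => h.
have {}h : 0 <= (2 * (`|x| * `|y|)) * (`|x| * `|y| - ip x y) by nra.
by rewrite pmulr_rge0 ?mulr_gt0// subr_ge0 in h.
Qed.

Variable S : R -> E -> E.
Hypothesis S_lin : forall t : R, 0 <= t -> linear (S t).
Hypothesis S_bdd : forall t : R, 0 <= t -> exists C : R, forall f, `|S t f| <= C * `|f|.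
Hypothesis S_0 : forall f, S 0 f = f.
Hypothesis S_D : forall (s t : R) f, 0 <= s -> 0 <= t -> S (s + t) f = S s (S t f).
Hypothesis S_cont : forall f (e : R), 0 < e ->
  exists2 d : R, 0 < d & forall t : R, 0 < t < d -> `|S t f - f| <= e.

Lemma evol0 t : 0 <= t -> S t 0 = 0.
Proof.
by move=> /S_lin/(_ (-1) 0 0); rewrite scaler0 addr0 scaleN1r addNr.
Qed.
Lemma evolD t x y : 0 <= t -> S t (x + y) = S t x + S t y.
Proof. by move=> /S_lin/(_ 1 x y); rewrite !scale1r. Qed.
Lemma evolZ t c x : 0 <= t -> S t (c *: x) = c *: S t x.
Proof. by move=> t0; rewrite -[c *: x]addr0 S_lin// evol0// addr0. Qed.
Lemma evolB t x y : 0 <= t -> S t (x - y) = S t x - S t y.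
Proof. by move=> t0; rewrite evolD// -scaleN1r evolZ// scaleN1r. Qed.
(** If the norms were unbounded near 0 there would be times t_n -> 0 with
    operator norms beyond n, although strong continuity at 0 bounds the
    family S(t_n) pointwise: this contradicts the Banach-Steinhaus theorem. *)
Lemma semigroup_bounded_near0 :
  exists C d : R, [/\ 0 <= C, 0 < d &
    forall (t : R) f, 0 <= t <= d -> `|S t f| <= C * `|f|].
Proof.
apply: contrapT => H.
have step (n : nat) : exists t, 0 <= t <= n.+1%:R^-1 /\
    exists f, n%:R * `|f| < `|S t f|.
  apply: contrapT => Hn; apply: H; exists n%:R, n.+1%:R^-1; split => // t f tn.
  rewrite leNgt; apply/negP => h; apply: Hn.
  by exists t; split => //; exists f.
have /choice[t /all_and2[tn fn]] := step.
have t0 n : 0 <= t n by case/andP: (tn n).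
pose F : set (E -> E) := [set S (t n) | n in [set: nat]].
have FP g : F g -> bounded_fun_norm g /\ linear g.
  move=> [n _ <-]; split; last exact: S_lin.
  move=> r; have [C hC] := S_bdd (t0 n).
  exists (`|C| * r) => x xr; apply: (le_trans (hC x)).
  apply: (@le_trans _ _ (`|C| * `|x|)); first by rewrite ler_wpM2r// ler_norm.
  by rewrite ler_wpM2l.
have Fb : pointwise_bounded F.
  move=> x; have [d d0 hd] := S_cont x ltr01.
  pose N := (Num.truncn d^-1).+1.
  exists (\sum_(i < N) `|S (t i) x| + (`|x| + 1)) => _ [n _ <-].
  have [nN|Nn] := ltnP n N.
    rewrite (bigD1 (Ordinal nN)) //= -addrA lerDl addr_ge0 ?addr_ge0//.
    by rewrite sumr_ge0.
  rewrite -[leLHS]add0r lerD ?sumr_ge0//.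
  have [tn0|tn0] := eqVneq (t n) 0; first by rewrite tn0 S_0 lerDl.
  rewrite -(subrK x (S (t n) x)) addrC (le_trans (ler_normD _ _))// lerD2l.
  apply: hd; rewrite lt_neqAle eq_sym tn0 t0 /=.
  case/andP: (tn n) => _ /le_lt_trans; apply.
  rewrite -[ltRHS]invrK ltf_pV2 ?posrE ?invr_gt0//.
  apply: (@lt_le_trans _ _ N%:R); first exact: Num.Theory.truncnS_gt.
  by rewrite ler_nat leqW.
have [M hM] := Banach_Steinhauss FP Fb 1.
have [f hf] := fn (Num.truncn M).+1; set n := (Num.truncn M).+1 in hf.
have f0 : 0 < `|f|.
  rewrite normr_gt0; apply: contraPN hf => /eqP ->.
  by rewrite normr0 mulr0 evol0// normr0 ltxx.
have : `|S (t n) (`|f|^-1 *: f)| <= M.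
  apply: hM; first by exists n.
  by rewrite normrZ normfV normr_id mulVf ?gt_eqF.
rewrite evolZ// normrZ normfV normr_id mulrC ler_pdivrMr// => h.
have := lt_le_trans hf h; rewrite ltr_pM2r// ltNge.
by rewrite (ltW (Num.Theory.truncnS_gt _)).
Qed.

Lemma semigroup_bounded_on T : exists2 C : R, 0 <= C &
  forall (t : R) f, 0 <= t <= T -> `|S t f| <= C * `|f|.
Proof.
have [C [d [C0 d0 hC]]] := semigroup_bounded_near0.
(* At least 1, so that the powers of D increase. *)
pose D := Num.max C 1.
have D0 : 0 <= D by rewrite le_max C0.
have hn n t f : 0 <= t <= n%:R * d -> `|S t f| <= D ^+ n * `|f|.
  elim: n t => [|n IH] t /andP[t0 tn].
    by rewrite mul0r in tn; rewrite (@le_anti _ _ t 0) ?t0 ?tn// S_0 expr0 mul1r.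
  pose r := Num.min t d.
  have r0 : 0 <= r by rewrite le_min t0 ltW.
  have rt : 0 <= t - r by rewrite subr_ge0 ge_min lexx.
  rewrite -(subrKC r t) S_D//.
  apply: (@le_trans _ _ (D * `|S (t - r) f|)).
    apply: (le_trans (hC _ _ _)); first by rewrite r0 ge_min lexx orbT.
    by rewrite ler_wpM2r// le_max lexx.
  rewrite exprS -mulrA ler_wpM2l// IH// rt /= lerBlDr.
  rewrite /r; case: (leP t d) => td; last by move: tn; rewrite -natr1; lra.
  by rewrite lerDr mulr_ge0// ltW.
exists (D ^+ (Num.truncn (T / d)).+1); first by rewrite exprn_ge0.
move=> t f /andP[t0 tT]; apply: hn; rewrite t0 (le_trans tT)//.
by rewrite -ler_pdivrMr// ltW// Num.Theory.truncnS_gt.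
Qed.

(** [generates f g] says that f is in the domain of the generator - A of S, and
    that A f = g. *)
Definition generates f g : Prop := forall e : R, 0 < e ->
  exists2 d : R, 0 < d & forall t : R, 0 < t < d -> `|t^-1 *: (f - S t f) - g| <= e.

Lemma generates_lin c f g f' g' : generates f g -> generates f' g' ->
  generates (c *: f + f') (c *: g + g').
Proof.
move=> fg fg' e e0.
have c0 : 0 < 2 * (`|c| + 1) by rewrite mulr_gt0// ltr_wpDl.
have [d d0 hd] := fg _ (divr_gt0 e0 c0).
have [d' d0' hd'] := fg' (e / 2) (divr_gt0 e0 (ltr0Sn _ 1)).
exists (Num.min d d') => [|t]; first by rewrite lt_min d0.
rewrite lt_min => /and3P[t0 td td'].
have -> : t^-1 *: (c *: f + f' - S t (c *: f + f')) - (c *: g + g') =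
  c *: (t^-1 *: (f - S t f) - g) + (t^-1 *: (f' - S t f') - g').
  rewrite S_lin ?ltW// opprD addrACA -scalerBr scalerDr scalerA mulrC -scalerA.
  by rewrite opprD addrACA -scalerBr.
rewrite (le_trans (ler_normD _ _))// (splitr e) lerD//; last first.
  by apply: hd'; rewrite t0.
rewrite normrZ; have := hd t; rewrite t0 td => /(_ isT) h.
apply: (@le_trans _ _ ((`|c| + 1) * (e / (2 * (`|c| + 1))))).
  by rewrite ler_pM// lerDl.
by rewrite le_eqVlt; apply/orP; left; apply/eqP; field; lra.
Qed.


(** The difference quotient of S f at time t is S(t) applied to the one at
    time 0, and S is bounded on [0, T].  This uniformity replaces the calculus of
    vector-valued functions: derivatives become increments over a uniform grid
    of step tau, with errors o(tau) that can be added up. *)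
Lemma generates_uniform f g (T e : R) : generates f g -> 0 <= T -> 0 < e ->
  exists2 d : R, 0 < d & forall t s : R, 0 <= t <= T -> 0 < s < d ->
    `|s^-1 *: (S t f - S s (S t f)) - S t g| <= e.
Proof.
move=> fg T0 e0; have [C C0 hC] := semigroup_bounded_on T.
have C1 : 0 < C + 1 by rewrite ltr_wpDl.
have [d d0 hd] := fg _ (divr_gt0 e0 C1).
exists d => // t s tT sd; have /andP[t0 _] := tT; have /andP[s0 _] := sd.
rewrite -S_D ?(ltW s0)// (addrC s t) S_D ?(ltW s0)// -evolB// -evolZ// -evolB//.
apply: (le_trans (hC _ _ tT)).
apply: (@le_trans _ _ ((C + 1) * (e / (C + 1)))); last first.
  by rewrite mulrC divfK ?gt_eqF.
by rewrite ler_pM// ?lerDl// hd.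
Qed.

Lemma generates_S f g t : generates f g -> 0 <= t -> generates (S t f) (S t g).
Proof.
move=> fg t0 e e0; have [d d0 hd] := generates_uniform fg t0 e0.
by exists d => // s sd; apply: hd; rewrite ?t0 ?lexx.
Qed.

Lemma step_remainder f g s e : 0 < s ->
  `|s^-1 *: (f - S s f) - g| <= e ->
  exists2 r, S s f = f - s *: (g + r) & `|r| <= e.
Proof.
move=> s0 h; exists (s^-1 *: (f - S s f) - g) => //.
by rewrite addrCA subrr addr0 scalerA divff ?gt_eqF// scale1r opprB addrCA subrr addr0.
Qed.

Lemma telescope_le (F : nat -> R) n (c : R) :
  (forall k, (k < n)%N -> F k.+1 <= F k + c) -> F n <= F 0 + n%:R * c.
Proof.
elim: n => [|n IH] h; first by rewrite mul0r addr0.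
apply: (le_trans (h n (ltnSn n))); rewrite -natr1 mulrDl mul1r addrA lerD2r.
by apply: IH => k kn; apply: h; rewrite ltnS ltnW.
Qed.

Lemma exists_fine_step (T d : R) : 0 < T -> 0 < d ->
  exists n, 0 < T / n.+1%:R < d.
Proof.
move=> T0 d0; exists (Num.truncn (T / d)); rewrite divr_gt0//=.
by rewrite ltr_pdivrMr// mulrC -ltr_pdivrMr// Num.Theory.truncnS_gt.
Qed.

Hypothesis gen_sym : forall f g f' g', generates f g -> generates f' g' ->
  ip g f' = ip f g'.
Hypothesis gen_ge0 : forall f g, generates f g -> 0 <= ip g f.

(** Since A is symmetric, s |-> <S(s) f, S(T - s) f'> has derivative zero; its
    increment over each of the n steps of size T / n is o(T / n). *)
Lemma semigroup_sym_le f g f' g' T : generates f g -> generates f' g' ->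
  0 <= T -> ip (S T f) f' <= ip f (S T f').
Proof.
move=> fg fg'; rewrite le_eqVlt => /predU1P[<-|T0]; first by rewrite !S_0.
have [C C0 hC] := semigroup_bounded_on T.
pose K := C * (`|f| + `|f'|).
have K0 : 0 <= K by rewrite mulr_ge0// addr_ge0.
have TK : 0 < T * K + 1 by rewrite ltr_wpDl// mulr_ge0// ltW.
apply/ler_addgt0Pr => eta eta0; pose e := eta / (T * K + 1).
have e0 : 0 < e by rewrite divr_gt0.
have [d d0 hd] := generates_uniform fg (ltW T0) e0.
have [d' d0' hd'] := generates_uniform fg' (ltW T0) e0.
have [n] : exists n, 0 < T / n.+1%:R < Num.min d d'.
  by apply: exists_fine_step; rewrite ?lt_min ?d0.
set tau := T / _; rewrite lt_min => /and3P[tau0 taud taud'].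
have nT : n.+1%:R * tau = T by rewrite mulrC divfK// pnatr_eq0.
have := @telescope_le (fun k => ip (S (k%:R * tau) f) (S (T - k%:R * tau) f'))
   n.+1 (tau * e * K).
rewrite nT subrr mul0r subr0 !S_0 => tel; apply: (le_trans (tel _)); last first.
  have -> : n.+1%:R * (tau * e * K) = e * (n.+1%:R * tau * K) by ring.
  rewrite lerD2l nT /e mulrAC ler_pdivrMr// ler_wpM2l ?(ltW eta0)//.
  by rewrite lerDl.

move=> k kn.
have k0 : 0 <= k%:R * tau by rewrite mulr_ge0// ltW.
have kT : k.+1%:R * tau <= T by rewrite -nT ler_wpM2r ?(ltW tau0)// ler_nat.
have kT' : k%:R * tau <= T.
  by apply: le_trans kT; rewrite ler_wpM2r ?(ltW tau0)// ler_nat.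
have k1 : 0 <= T - k.+1%:R * tau by rewrite subr_ge0.
have k1T : T - k.+1%:R * tau <= T by rewrite gerBl mulr_ge0// ltW.
have := hd (k%:R * tau) tau; rewrite k0 kT' tau0 taud => /(_ isT isT).
have := hd' (T - k.+1%:R * tau) tau.
rewrite k1 k1T tau0 taud' => /(_ isT isT).
set p := S (k%:R * tau) f; set r := S (T - k.+1%:R * tau) f'.
move=> /(step_remainder tau0)[e2 E2 n2] /(step_remainder tau0)[e1 E1 n1].
have -> : S (k.+1%:R * tau) f = S tau p.
  by rewrite -S_D// ?(ltW tau0)// -nat1r mulrDl mul1r.
have -> : S (T - k%:R * tau) f' = S tau r.
  rewrite -S_D// ?(ltW tau0)//; congr (S _ _); rewrite -nat1r; ring.
rewrite E1 E2 ipBl ipBr ipZl ipZr ipDl ipDr.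
rewrite (gen_sym (generates_S fg k0) (generates_S fg' k1)) -/p -/r.
have h1 : - ip e1 r <= e * (C * `|f'|).
  rewrite -ipNl; apply: (le_trans (ip_le _ _)); rewrite normrN ler_pM//.
  by apply: hC; rewrite k1 gerBl mulr_ge0// ltW.
have h2 : ip p e2 <= (C * `|f|) * e.
  apply: (le_trans (ip_le _ _)); rewrite ler_pM//.
  by apply: hC; rewrite k0.
have : tau * (ip p e2 - ip e1 r) <= tau * (e * K).
  rewrite ler_wpM2l ?(ltW tau0)// /K mulrDr mulrDr.
  by rewrite lerD// mulrC.
nra.
Qed.

Lemma semigroup_sym f g f' g' T : generates f g -> generates f' g' ->
  0 <= T -> ip (S T f) f' = ip f (S T f').
Proof.
move=> fg fg' T0; apply/le_anti; rewrite (semigroup_sym_le fg fg')//=.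
by rewrite ipC [leRHS]ipC (semigroup_sym_le fg' fg).
Qed.

(** The derivative of |S(t) f|^2 is - 2 <A S(t) f, S(t) f> <= 0. *)
Lemma semigroup_contract f g T : generates f g -> 0 <= T -> `|S T f| <= `|f|.
Proof.
move=> fg; rewrite le_eqVlt => /predU1P[<-|T0]; first by rewrite S_0.
have [C C0 hC] := semigroup_bounded_on T.
pose K := 2 * (C * `|f|) + (C * `|g| + 1) ^+ 2.
have K0 : 0 <= K by rewrite addr_ge0 ?sqr_ge0// !mulr_ge0.
have TK : 0 < T * K + 1 by rewrite ltr_wpDl// mulr_ge0// ltW.
rewrite -(@ler_pXn2r _ 2)// ?nnegrE//.
apply/ler_addgt0Pr => eta eta0.
pose e := Num.min 1 (eta / (T * K + 1)).
have e0 : 0 < e by rewrite lt_min ltr01 divr_gt0.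
have e1 : e <= 1 by rewrite ge_min lexx.
have [d d0 hd] := generates_uniform fg (ltW T0) e0.
have [n] : exists n, 0 < T / n.+1%:R < Num.min d e.
  by apply: exists_fine_step; rewrite // lt_min d0.
set tau := T / _; rewrite lt_min => /and3P[tau0 taud taue].
have nT : n.+1%:R * tau = T by rewrite mulrC divfK// pnatr_eq0.
have := @telescope_le (fun k => `|S (k%:R * tau) f| ^+ 2) n.+1 (tau * (e * K)).
rewrite nT mul0r !S_0 => tel; apply: (le_trans (tel _)); last first.
  have -> : n.+1%:R * (tau * (e * K)) = e * (n.+1%:R * tau * K) by ring.
  rewrite lerD2l nT.
  apply: (@le_trans _ _ (eta / (T * K + 1) * (T * K))).
    by rewrite ler_wpM2r ?mulr_ge0 ?(ltW T0)// ge_min lexx orbT.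
  by rewrite mulrAC ler_pdivrMr// ler_wpM2l ?(ltW eta0)// lerDl.
move=> k kn.
have k0 : 0 <= k%:R * tau by rewrite mulr_ge0// ltW.
have kT : k%:R * tau <= T by rewrite -nT ler_wpM2r ?(ltW tau0)// ler_nat ltnW.
have := hd (k%:R * tau) tau; rewrite k0 kT tau0 taud => /(_ isT isT).
set p := S (k%:R * tau) f.
move=> /(step_remainder tau0)[r Er nr].
have -> : S (k.+1%:R * tau) f = S tau p.
  by rewrite -S_D// ?(ltW tau0)// -nat1r mulrDl mul1r.
have np : `|p| <= C * `|f| by apply: hC; rewrite k0.
have ng : `|S (k%:R * tau) g| <= C * `|g| by apply: hC; rewrite k0.
rewrite Er -!ip_norm ipBl !ipBr !ipZl !ipZr (ipC p).
have h1 : - ip r p <= e * (C * `|f|).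
  by rewrite -ipNl (le_trans (ip_le _ _))// normrN ler_pM.
have h2 : ip (S (k%:R * tau) g + r) (S (k%:R * tau) g + r) <= (C * `|g| + 1) ^+ 2.
  rewrite ip_norm ler_pXn2r// ?nnegrE// ?addr_ge0 ?mulr_ge0//.
  by rewrite (le_trans (ler_normD _ _))// lerD// (le_trans nr).
have h3 := gen_ge0 (generates_S fg k0); rewrite -/p in h3.
rewrite ipDl; set G := ip (_ + r) (_ + r) in h2 *.
have h4 : tau * G <= e * (C * `|g| + 1) ^+ 2.
  by rewrite ler_pM// ?(ltW tau0) ?(ltW taue)// /G ip_norm sqr_ge0.
have : tau * (- 2 * (ip (S (k%:R * tau) g) p + ip r p) + tau * G) <= tau * (e * K).
  rewrite ler_wpM2l ?(ltW tau0)// /K; lra.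
lra.
Qed.


(** This makes t |-> <S(t) f, f> nonnegative and nonincreasing, so that its
    integral exists although nothing is known about the sign of S(t) f. *)
Lemma autocorrelation_sqr f g t : generates f g -> 0 <= t ->
  ip (S t f) f = `|S (t / 2) f| ^+ 2.
Proof.
move=> fg t0; have t2 : 0 <= t / 2 by rewrite divr_ge0.
rewrite {1}(splitr t) S_D// (semigroup_sym (generates_S fg t2) fg t2).
by rewrite ip_norm.
Qed.

Lemma autocorrelation_ge0 f g t : generates f g -> 0 <= t -> 0 <= ip (S t f) f.
Proof. by move=> fg t0; rewrite (autocorrelation_sqr fg t0) sqr_ge0. Qed.

Lemma autocorrelation_noninc f g s t : generates f g -> 0 <= s -> s <= t ->
  ip (S t f) f <= ip (S s f) f.
Proof.
move=> fg s0 st; have t0 := le_trans s0 st.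
have s2 : 0 <= s / 2 by rewrite divr_ge0.
have ts : 0 <= (t - s) / 2 by rewrite divr_ge0// subr_ge0.
rewrite !(autocorrelation_sqr fg)// ler_pXn2r// ?nnegrE//.
rewrite (_ : t / 2 = (t - s) / 2 + s / 2); last by field.
by rewrite S_D// (semigroup_contract (generates_S fg s2)).
Qed.

Lemma generates0 : generates 0 0.
Proof.
move=> e e0; exists 1 => // t /andP[t0 _].
by rewrite (evol0 (ltW t0)) !subr0 scaler0 normr0 ltW.
Qed.

Lemma generatesZ c f g : generates f g -> generates (c *: f) (c *: g).
Proof.
move=> fg; have := generates_lin c fg generates0.
by rewrite !addr0.
Qed.

Lemma generatesB f g f' g' : generates f g -> generates f' g' ->
  generates (f - f') (g - g').
Proof.
by move=> fg fg'; rewrite addrC [g - _]addrC -(scaleN1r f') -(scaleN1r g'); exact: generates_lin.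
Qed.

Lemma generates_sum n (F G : nat -> E) : (forall j, generates (F j) (G j)) ->
  generates (\sum_(j < n) F j) (\sum_(j < n) G j).
Proof.
move=> FG; elim: n => [|n IH]; first by rewrite !big_ord0; exact: generates0.
rewrite !big_ord_recr /= addrC [X in generates _ X]addrC -[F n]scale1r.
by rewrite -[G n]scale1r; exact: generates_lin.
Qed.

Lemma semigroup_telescope n (tau : R) f : 0 <= tau ->
  \sum_(j < n) S (j%:R * tau) (f - S tau f) = f - S (n%:R * tau) f.
Proof.
move=> tau0; elim: n => [|n IH]; first by rewrite big_ord0 mul0r S_0 subrr.
rewrite big_ord_recr /= IH evolB ?mulr_ge0// -S_D ?mulr_ge0// addrA subrK.
by rewrite -natr1 mulrDl mul1r.
Qed.

(** Test the hypothesis with h = tau sum_j S(j tau) f, an approximation of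
    A^-1 f: then <f, h> is the Riemann sum itself, and A h is, up to a small
    error, tau sum_j S(j tau) (f - S(tau) f) / tau = f - S(T) f by telescoping, so
    that <A h, h> <= <f, h> up to that error. *)
Lemma riemann_sum_le f g (M T e : R) : generates f g ->
  (forall h k, generates h k -> 2 * ip f h - ip k h <= M) -> 0 < T -> 0 < e ->
  exists n, T / n.+1%:R *
    \sum_(j < n.+1) ip (S (j%:R * (T / n.+1%:R)) f) f <= M + e.
Proof.
move=> fg hM T0 e0.
have [C C0 hC] := semigroup_bounded_on T.
pose K := T * C * (T * `|f|).
have K0 : 0 <= K by rewrite !mulr_ge0// ltW.
have K1 : 0 < K + 1 by rewrite ltr_wpDl.
have [d d0 hd] := fg _ (divr_gt0 e0 K1).
have [n nd] := exists_fine_step T0 d0; exists n; move: nd.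
set tau := T / _ => taud; have /andP[tau0 _] := taud.
have nT : n.+1%:R * tau = T by rewrite mulrC divfK// pnatr_eq0.
have [r Er nr] := step_remainder tau0 (hd _ taud).
have j0 (j : nat) : 0 <= j%:R * tau by rewrite mulr_ge0// ltW.
set beta := tau * _.
pose h := tau *: \sum_(j < n.+1) S (j%:R * tau) f.
pose k := tau *: \sum_(j < n.+1) S (j%:R * tau) g.
have hk : generates h k.
  apply: generatesZ; apply: (@generates_sum _ (fun j => S (j%:R * tau) f)
    (fun j => S (j%:R * tau) g)) => j; exact: generates_S.
have betaE : ip f h = beta.
  rewrite ipZr ip_sumr; congr (_ * _).
  by apply: eq_bigr => j _; rewrite ipC.
pose err := tau *: \sum_(j < n.+1) S (j%:R * tau) r.
have kE : k = (f - S T f) - err.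
  have fr : f - S tau f = tau *: (g + r).
    by rewrite Er opprB addrCA subrr addr0.
  rewrite -{1}nT -semigroup_telescope ?(ltW tau0)// /err /k fr.
  rewrite !scaler_sumr -sumrB; apply: eq_bigr => j _.
  by rewrite evolZ// evolD// scalerDr addrK.
have hle : `|h| <= T * `|f|.
  rewrite normrZ gtr0_norm// -nT (mulrC n.+1%:R tau) -[leRHS]mulrA ler_wpM2l ?(ltW tau0)//.
  apply: (le_trans (ler_norm_sum _ _ _)).
  rewrite mulr_natl -[X in _ *+ X]card_ord -sumr_const; apply: ler_sum => j _.
  exact: semigroup_contract fg _.
have errle : `|err| <= T * (C * (e / (K + 1))).
  rewrite normrZ gtr0_norm// -nT (mulrC n.+1%:R tau) -[leRHS]mulrA ler_wpM2l ?(ltW tau0)//.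
  apply: (le_trans (ler_norm_sum _ _ _)).
  rewrite mulr_natl -[X in _ *+ X]card_ord -sumr_const; apply: ler_sum => j _.
  apply: (@le_trans _ _ (C * `|r|)); last by rewrite ler_wpM2l.
  apply: hC; rewrite j0 -nT ler_wpM2r ?(ltW tau0)// ler_nat.
  by rewrite ltnW.
have STh : 0 <= ip (S T f) h.
  rewrite ipZr ip_sumr mulr_ge0 ?(ltW tau0)// sumr_ge0// => j _.
  rewrite -(semigroup_sym (generates_S fg (ltW T0)) fg (j0 j)) -S_D ?(ltW T0)//.
  by rewrite (autocorrelation_ge0 fg)// addr_ge0 ?(ltW T0).
have errh : - ip err h <= e.
  rewrite -ipNl (le_trans (ip_le _ _))// normrN.
  apply: (@le_trans _ _ (T * (C * (e / (K + 1))) * (T * `|f|))).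
    by rewrite ler_pM.
  have -> : T * (C * (e / (K + 1))) * (T * `|f|) = e / (K + 1) * K.
    by rewrite /K; ring.
  by rewrite mulrAC ler_pdivrMr// ler_wpM2l ?(ltW e0)// lerDl.
have := hM _ _ hk; rewrite betaE kE !ipBl betaE; lra.
Qed.

(** t |S(t) f|^2 is dominated by Riemann sums of the nonincreasing function
    t |-> <S(t) f, f>, and these are bounded. *)
Lemma semigroup_decay f g (M e : R) : generates f g ->
  (forall h k, generates h k -> 2 * ip f h - ip k h <= M) -> 0 < e ->
  exists2 t0 : R, 0 < t0 & forall t, t0 <= t -> `|S t f| <= e.
Proof.
move=> fg hM e0.
have M0 : 0 <= M.
  by have := hM _ _ generates0; rewrite ip0r mulr0 ip0l subrr.
exists ((M + 1) / e ^+ 2) => [|t t0].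
  by rewrite divr_gt0 ?exprn_gt0// ltr_wpDl.
have tp : 0 < t.
  by apply: lt_le_trans t0; rewrite divr_gt0 ?exprn_gt0// ltr_wpDl.
rewrite -(@ler_pXn2r _ 2)// ?nnegrE ?(ltW e0)//.
have t2 : 0 < 2 * t by rewrite mulr_gt0.
have [n] := riemann_sum_le fg hM t2 ltr01.
set tau := 2 * t / _ => hn.
have nT : n.+1%:R * tau = 2 * t by rewrite mulrC divfK// pnatr_eq0.
have tau0 : 0 <= tau by rewrite divr_ge0// ltW.
have : 2 * t * `|S t f| ^+ 2 <= M + 1.
  apply: le_trans hn; rewrite -nT (mulrC n.+1%:R tau) -mulrA ler_wpM2l// mulr_natl.
  rewrite -[X in _ *+ X]card_ord -sumr_const; apply: ler_sum => j _.
  rewrite (_ : `|S t f| ^+ 2 = ip (S (2 * t) f) f).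
    have jT : j%:R * tau <= 2 * t by rewrite -nT ler_wpM2r// ler_nat ltnW.
    by apply: (autocorrelation_noninc fg _ jT); rewrite mulr_ge0.
  rewrite (autocorrelation_sqr fg) ?(ltW t2)//.
  by rewrite (_ : 2 * t / 2 = t)//; field.
move: t0; rewrite ler_pdivrMr ?exprn_gt0// => t0 h.
have h2 : t * `|S t f| ^+ 2 <= t * e ^+ 2.
  apply: le_trans t0; apply: le_trans h; rewrite ler_wpM2r ?sqr_ge0//; lra.
by rewrite ler_pM2l in h2.
Qed.

(** Let z = (phi - S(tau) phi) / tau, which tends to A phi = k.  The Riemann sum
    for f - z is nonnegative; expanded, its terms containing z telescope, and
    what remains is the Riemann sum for f minus (2 <f, phi> - <z, phi>), up to
    terms in S(n tau) phi, which tend to 0 by decay. *)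
Lemma riemann_sum_ge f g phi k (e : R) : generates f g -> generates phi k ->
  (forall e : R, 0 < e -> exists2 t0 : R, 0 < t0 &
     forall t, t0 <= t -> `|S t phi| <= e) ->
  0 < e ->
  exists n tau, 0 < tau < e /\ 2 * ip f phi - ip k phi - e <=
    tau * \sum_(j < n) ip (S (j%:R * tau) f) f.
Proof.
move=> fg phik decay e0.
have p1 : 0 < 2 * (`|phi| + 1) by rewrite mulr_gt0// ltr_wpDl.
have [d d0 hd] := phik _ (divr_gt0 e0 p1).
(* Below d, so that z is close to k, and below e. *)
pose tau := Num.min d e / 2.
have tau0 : 0 < tau by rewrite divr_gt0// lt_min d0.
have taum : tau < Num.min d e by rewrite ltr_pdivrMr// ltr_pMr ?lt_min ?d0// ltr1n.
have /andP[taud taue] : (tau < d) && (tau < e) by rewrite -lt_min.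
pose z := tau^-1 *: (phi - S tau phi).
have zk : `|z - k| <= e / (2 * (`|phi| + 1)) by apply: hd; rewrite tau0.
have K0 : 0 < 2 * (2 * `|f| + `|z| + 1).
  by rewrite mulr_gt0// ltr_wpDl// addr_ge0// mulr_ge0.
have [t0 t00 ht0] := decay _ (divr_gt0 e0 K0).
(* From n tau on, S(t) phi is negligible against 2 |f| + |z|. *)
pose n := (Num.truncn (t0 / tau)).+1.
have nt0 : t0 <= n%:R * tau.
  by rewrite -ler_pdivrMr// ltW// Num.Theory.truncnS_gt.
have j0 (j : nat) : 0 <= j%:R * tau by rewrite mulr_ge0// ltW.
exists n, tau; rewrite tau0; split => //.
set beta := tau * _.
have [z' zz'] : exists z', generates z z'.
  exists (tau^-1 *: (k - S tau k)); apply: generatesZ; apply: generatesB => //.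
  exact: generates_S (ltW tau0).
set P := S (n%:R * tau) phi.
have Pz x : tau * (\sum_(j < n) ip (S (j%:R * tau) z) x) = ip (phi - P) x.
  rewrite -semigroup_telescope ?(ltW tau0)// ip_suml mulr_sumr.
  apply: eq_bigr => j _; rewrite evolZ// ipZl mulrA divff ?mul1r//.
  by rewrite gt_eqF.
have : 0 <= tau * \sum_(j < n) ip (S (j%:R * tau) (f - z)) (f - z).
  rewrite mulr_ge0 ?(ltW tau0)// sumr_ge0// => j _.
  exact: (autocorrelation_ge0 (generatesB fg zz')).
have -> : \sum_(j < n) ip (S (j%:R * tau) (f - z)) (f - z) =
    \sum_(j < n) ip (S (j%:R * tau) f) f
    - 2 * (\sum_(j < n) ip (S (j%:R * tau) z) f)
    + \sum_(j < n) ip (S (j%:R * tau) z) z.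
  rewrite mulr_sumr -sumrB -big_split; apply: eq_bigr => j _ /=.
  rewrite evolB// ipBl !ipBr (semigroup_sym fg zz' (j0 j)) (ipC f); ring.
rewrite mulrDr mulrBr mulrCA !Pz -/beta !ipBl (ipC f) => h.
have h1 : - (ip P z) + 2 * ip P f <= e / 2.
  apply: (@le_trans _ _ (`|P| * (2 * `|f| + `|z|))).
    rewrite addrC mulrDr lerD//; last by rewrite -ipNl (le_trans (ip_le _ _))// normrN.
    by rewrite mulrCA ler_wpM2l// ip_le.
  apply: (@le_trans _ _ (e / (2 * (2 * `|f| + `|z| + 1)) * (2 * `|f| + `|z| + 1))).
    rewrite ler_pM// ?addr_ge0 ?mulr_ge0// ?lerDl//.
    exact: ht0.
  by rewrite le_eqVlt; apply/orP; left; apply/eqP; field; rewrite gt_eqF//; lra.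
have h2 : ip phi z <= ip k phi + e / 2.
  rewrite -lerBlDl (ipC k) -ipBr (le_trans (ip_le _ _))//.
  apply: (@le_trans _ _ ((`|phi| + 1) * (e / (2 * (`|phi| + 1))))).
    by rewrite ler_pM// lerDl.
  by rewrite le_eqVlt; apply/orP; left; apply/eqP; field; rewrite gt_eqF//; lra.
lra.
Qed.

Local Notation mu := (@lebesgue_measure R).
Local Notation halfline := (`[0%R, +oo[%classic : set R).

(* Constant to the left of 0, so that monotonicity holds on the whole line. *)
Let ext (m : R -> R) (t : R) : R := m (Num.max t 0).

Let ext_noninc f g : generates f g ->
  nonincreasing_fun (ext (fun t => ip (S t f) f)).
Proof.
move=> fg s t st; apply: (autocorrelation_noninc fg).
  by rewrite le_max lexx orbT.
by rewrite ge_max !le_max lexx orbT st.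
Qed.

Let ext_ge0 f g : generates f g ->
  forall t, 0 <= ext (fun t => ip (S t f) f) t.
Proof.
by move=> fg t; apply: (autocorrelation_ge0 fg); rewrite le_max lexx orbT.
Qed.

Let ext_integral (m : R -> R) :
  (\int[mu]_(t in halfline) (m t)%:E = \int[mu]_(t in halfline) (ext m t)%:E)%E.
Proof.
apply: eq_integral => t; rewrite inE/= in_itv/= andbT => t0.
by rewrite /ext max_l.
Qed.

Let potential f : \bar R := (\int[mu]_(t in halfline) (ip (S t f) f)%:E)%E.

Lemma potential_le f g (M : R) : generates f g ->
  (forall h k, generates h k -> 2 * ip f h - ip k h <= M) ->
  (potential f <= M%:E)%E.
Proof.
move=> fg hM; rewrite /potential ext_integral.
apply: integral_halfline_le; [exact: ext_noninc fg|exact: ext_ge0 fg|].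
move=> T e T0 e0; have [n hn] := riemann_sum_le fg hM T0 e0; exists n.
apply: le_trans hn; rewrite ler_wpM2l ?divr_ge0 ?(ltW T0)//.
apply: ler_sum => j _; rewrite /ext max_l// mulr_ge0// divr_ge0//.
exact: ltW.
Qed.

Lemma potential_ge0 f g : generates f g -> (0 <= potential f)%E.
Proof.
move=> fg; apply: integral_ge0 => t /=; rewrite in_itv/= andbT => t0.
by rewrite lee_fin (autocorrelation_ge0 fg).
Qed.

Lemma potential_ge f g phi k (M : R) : generates f g -> generates phi k ->
  (forall h k, generates h k -> 2 * ip phi h - ip k h <= M) ->
  ((2 * ip f phi - ip k phi)%:E <= potential f)%E.
Proof.
move=> fg phik hM; apply/lee_addgt0Pr => e e0.
have f1 : 0 < `|f| ^+ 2 + 1 by rewrite ltr_wpDl// exprn_ge0.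
have e2 : 0 < e / (2 * (`|f| ^+ 2 + 1)) by rewrite divr_gt0// mulr_gt0.
have dec := semigroup_decay phik hM.
have [n [tau [/andP[tau0 taue] h]]] := riemann_sum_ge fg phik dec e2.
have := integral_halfline_ge (ext_noninc fg) (ext_ge0 fg) n (ltW tau0).
rewrite -ext_integral -/(potential f) /ext maxxx S_0 ip_norm => h2.
have {h2} : ((tau * \sum_(j < n) ip (S (j%:R * tau) f) f)%:E - (tau * `|f| ^+ 2)%:E
    <= potential f)%E.
  apply: le_trans h2; rewrite leeD2r// lee_fin ler_wpM2l ?(ltW tau0)//.
  by apply: ler_sum => j _; rewrite max_l// mulr_ge0// ltW.
move=> h2; have {h2} := leeD2r e%:E h2; apply: le_trans.
rewrite -EFinB -EFinD lee_fin.
have h3 : tau * `|f| ^+ 2 <= e / (2 * (`|f| ^+ 2 + 1)) * `|f| ^+ 2.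
  by rewrite ler_wpM2r ?exprn_ge0// ltW.
have h4 : e / (2 * (`|f| ^+ 2 + 1)) * (`|f| ^+ 2 + 1) = e / 2.
  by field; rewrite gt_eqF.
have h5 : 0 <= `|f| ^+ 2 by rewrite exprn_ge0.
move: h h3 h4 e2; set B := tau * \sum_(j < n) _; set c := e / (2 * _).
nra.
Qed.

Lemma polarization u u' v v' t : generates u u' -> generates v v' -> 0 <= t ->
  ip (S t u) v =
  4^-1 * (ip (S t (u + v)) (u + v) - ip (S t (u - v)) (u - v)).
Proof.
move=> uu vv t0.
rewrite evolD// evolB// ipDl ipBl !ipBr !ipDr.
by rewrite (semigroup_sym vv uu t0) (ipC v (S t u)); field.
Qed.

Lemma potential_integrable f g : generates f g ->
  (potential f < +oo)%E -> mu.-integrable halfline (EFin \o (fun t => ip (S t f) f)).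
Proof.
move=> fg foo; have mD : measurable halfline by exact: measurable_itv.
apply: (@eq_integrable _ _ _ mu _ mD (EFin \o ext (fun t => ip (S t f) f))).
  move=> t; rewrite inE/= in_itv/= andbT => t0; by rewrite /ext max_l.
apply/integrableP; split.
  exact: (monotone_measurable (ext_noninc fg)).
move: foo; rewrite /potential ext_integral; congr (_ < _)%E.
by apply: eq_integral => t _ /=; rewrite ger0_norm// (ext_ge0 fg).
Qed.

(** Q f stands for <A^-1 f, f>.  The first two properties place it between the
    suprema of 2 <f, phi> - <A phi, phi> over D and over the domain of A, which
    coincide when D is a core; the last one is polarisation. *)
Theorem potential_variational (D : set E) (op : E -> E) :
  (forall f, D f -> generates f (op f)) ->
  (forall c f h, D f -> D h -> D (c *: f + h)) ->
  (forall f, D f -> exists M : R,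
     forall h k, generates h k -> 2 * ip f h - ip k h <= M) ->
  exists Q : E -> R, [/\
    forall f (M : R), D f ->
      (forall h k, generates h k -> 2 * ip f h - ip k h <= M) -> Q f <= M,
    forall f phi, D f -> D phi -> 2 * ip f phi - ip (op phi) phi <= Q f &
    forall u v, D u -> D v ->
      (\int[mu]_(t in halfline) (ip (S t u) v)%:E =
       (4^-1 * (Q (u + v) - Q (u - v)))%:E)%E].
Proof.
move=> Dgen Dlin Dbnd.
have pfin f : D f -> potential f \is a fin_num.
  move=> Df; have [M hM] := Dbnd _ Df.
  rewrite ge0_fin_numE ?(potential_ge0 (Dgen _ Df))//.
  by apply: le_lt_trans (potential_le (Dgen _ Df) hM) _; rewrite ltry.
exists (fun f => fine (potential f)); split.
- move=> f M Df hM; rewrite -lee_fin fineK ?pfin//.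
  exact: potential_le (Dgen _ Df) hM.
- move=> f phi Df Dphi; have [M hM] := Dbnd _ Dphi.
  rewrite -lee_fin fineK ?pfin//.
  exact: potential_ge (Dgen _ Df) (Dgen _ Dphi) hM.
move=> u v Du Dv.
have Dp : D (u + v) by have := Dlin 1 _ _ Du Dv; rewrite scale1r.
have Dm : D (u - v) by have := Dlin (-1) _ _ Dv Du; rewrite scaleN1r addrC.
have foo f : D f -> (potential f < +oo)%E.
  by move=> /pfin; rewrite fin_numElt => /andP[].
have i1 := potential_integrable (Dgen _ Dp) (foo _ Dp).
have i2 := potential_integrable (Dgen _ Dm) (foo _ Dm).
have mD : measurable halfline by exact: measurable_itv.
rewrite EFinM EFinB !fineK ?pfin//.
rewrite /potential -integralB_EFin// -integralZl//; last first.
  exact: integrableB.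
apply: eq_integral => t; rewrite inE/= in_itv/= andbT => t0.
by rewrite (polarization (Dgen _ Du) (Dgen _ Dv) t0) EFinM EFinB.
Qed.

End hilbert.

(** * The closure of a form on finitely supported functions *)

Lemma has_sum_embed (R : realType) (T T' : choiceType) (e : T -> T')
    (r : T' -> T) (g : T -> R) (f : T' -> R) (s : R) :
  cancel e r -> (forall y, f (e y) = g y) ->
  (forall z, e (r z) != z -> f z = 0) -> has_sum g s -> has_sum f s.
Proof.
move=> er fe f0 gs d d0; have [A hA] := gs _ d0.
exists [seq e y | y <- A] => B uB sB.
have -> : \sum_(z <- B) f z = \sum_(y <- [seq r z | z <- B & e (r z) == z]) g y.
  rewrite big_map big_filter (bigID (fun z => e (r z) == z)) /=.
  rewrite [X in _ + X]big1 => [|z /f0//]; rewrite addr0.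
  by apply: eq_bigr => z /eqP {1}<-; rewrite fe.
apply: hA.
  rewrite map_inj_in_uniq ?filter_uniq// => z z'.
  rewrite !mem_filter => /andP[/eqP h _] /andP[/eqP h' _] rr.
  by rewrite -h -h' rr.
move=> y yA; apply/mapP; exists (e y); last by rewrite er.
by rewrite mem_filter er eqxx sB// map_f.
Qed.

Lemma cvg_seqP (R : realType) (u : nat -> R) (l : R) :
  u n @[n --> \oo] --> l <->
  forall e : R, 0 < e -> exists N, forall n, (N <= n)%N -> `|u n - l| <= e.
Proof.
split=> [/cvgrPdist_le h e e0|h].
  have [N _ hN] := h _ e0; exists N => n Nn; rewrite distrC; exact: hN.
apply/cvgrPdist_le => e /h[N hN]; exists N => // n /= Nn.
by rewrite distrC; exact: hN.
Qed.

Section supports.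
Variables (R : realType) (X : choiceType).
Implicit Types (phi psi : X -> R) (K L : seq X).

Definition supported_in K phi := forall x, x \notin K -> phi x = 0.

Lemma supported_sub K L phi : {subset K <= L} -> supported_in K phi ->
  supported_in L phi.
Proof. by move=> KL h x xL; apply: h; apply: contra xL; exact: KL. Qed.

Lemma finitely_supportedP phi :
  finitely_supported phi <-> exists2 K, uniq K & supported_in K phi.
Proof.
split=> [/finite_seqP[s hs]|[K uK hK]].
  exists (undup s) => [|x]; first exact: undup_uniq.
  rewrite mem_undup => xs; apply/eqP/negP => /negP xphi.
  have : [set x | phi x != 0] x by [].
  by rewrite hs /= (negbTE xs).
apply: (@sub_finite_set _ _ [set` K]); last exact: finite_seq.
by move=> x /=; apply: contraNT => /hK ->.
Qed.

Lemma common_support (s : seq (X -> R)) L :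
  (forall phi, List.In phi s -> finitely_supported phi) ->
  exists K, [/\ uniq K, {subset L <= K} &
    forall phi, List.In phi s -> supported_in K phi].
Proof.
elim: s => [|phi s IH] hs.
  by exists (undup L); split => //; [exact: undup_uniq|move=> x; rewrite mem_undup].
have [K [uK LK hK]] := IH (fun psi h => hs psi (or_intror h)).
have /finitely_supportedP[M uM hM] := hs phi (or_introl erefl).
exists (undup (K ++ M)); split; first exact: undup_uniq.
  by move=> x /LK xK; rewrite mem_undup mem_cat xK.
move=> psi [<-|/hK].
  by apply: supported_sub hM => x xM; rewrite mem_undup mem_cat xM orbT.
by apply: supported_sub => x xK; rewrite mem_undup mem_cat xK.
Qed.

Lemma supported_lin K (c : R) phi psi :
  supported_in K phi -> supported_in K psi ->
  supported_in K (fun x => c * phi x + psi x).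
Proof. by move=> h1 h2 x xK; rewrite h1// h2// mulr0 addr0. Qed.

Lemma finitely_supported_lin (c : R) phi psi :
  finitely_supported phi -> finitely_supported psi ->
  finitely_supported (fun x => c * phi x + psi x).
Proof.
move=> h1 h2.
have [|K [uK _ hK]] := @common_support [:: phi; psi] [::].
  by move=> chi [<-|[<-|[]]].
apply/finitely_supportedP; exists K => //.
by apply: supported_lin; apply: hK => /=; tauto.
Qed.

Lemma finitely_supported0 : finitely_supported (fun _ : X => 0 : R).
Proof. by apply/finitely_supportedP; exists [::]. Qed.

Lemma finitely_supportedZ (c : R) phi : finitely_supported phi ->
  finitely_supported (fun x => c * phi x).
Proof.
move=> h; have := finitely_supported_lin c h finitely_supported0.
by congr finitely_supported; apply/funext => x; rewrite addr0.
Qed.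

Lemma finitely_supportedB phi psi :
  finitely_supported phi -> finitely_supported psi ->
  finitely_supported (fun x => phi x - psi x).
Proof.
move=> h1 h2; have := finitely_supported_lin (-1) h2 h1.
by congr finitely_supported; apply/funext => x; rewrite mulN1r addrC.
Qed.

Lemma l2_finitely_supported phi : finitely_supported phi -> l2 phi.
Proof.
move=> /finitely_supportedP[K uK hK].
apply/l2P; apply: (has_sum_abs_summable (s := \sum_(x <- K) phi x ^+ 2)).
by apply: has_sum_fin => // x /hK ->; rewrite expr0n.
Qed.

Lemma l2inner_fin K phi psi : uniq K -> supported_in K psi ->
  l2inner phi psi = \sum_(x <- K) phi x * psi x.
Proof.
move=> uK hK; apply/has_sum_tsum/has_sum_fin => // x /hK ->.
by rewrite mulr0.
Qed.

End supports.

Section form_theory.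
Variables (R : realType) (X : choiceType) (b : X -> X -> R) (V : X -> R).
Hypothesis graph_b : is_graph b.
Implicit Types (phi psi chi : X -> R) (K : seq X).

(** The form on functions supported in the finite set K; V is the sum of the
    weighted degree and of the potential. *)
Definition finite_form K phi psi : R :=
  \sum_(x <- K) V x * phi x * psi x
  - \sum_(x <- K) \sum_(y <- K) b x y * phi x * psi y.

Lemma finite_formC K phi psi : finite_form K phi psi = finite_form K psi phi.
Proof.
rewrite /finite_form; congr (_ - _); first by apply: eq_bigr => x _; ring.
rewrite exchange_big /=; apply: eq_bigr => x _; apply: eq_bigr => y _.
by rewrite (graph_sym graph_b); ring.
Qed.

Lemma finite_form_lin K c phi psi chi :
  finite_form K (fun x => c * phi x + psi x) chi =
  c * finite_form K phi chi + finite_form K psi chi.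
Proof.
rewrite /finite_form mulrBr addrACA -opprD !mulr_sumr -!big_split /=.
congr (_ - _); apply: eq_bigr => x _; first by ring.
by rewrite mulr_sumr -big_split /=; apply: eq_bigr => y _; ring.
Qed.

Variable a : (X -> R) -> (X -> R) -> R.
Hypothesis aE : forall K phi psi, uniq K -> supported_in K phi ->
  supported_in K psi -> a phi psi = finite_form K phi psi.
Hypothesis a_ge0 : forall phi, finitely_supported phi -> 0 <= a phi phi.

Lemma formC phi psi : finitely_supported phi -> finitely_supported psi ->
  a phi psi = a psi phi.
Proof.
move=> h1 h2; have [|K [uK _ hK]] := @common_support _ _ [:: phi; psi] [::].
  by move=> chi [<-|[<-|[]]].
have k1 : supported_in K phi by apply: hK => /=; tauto.
have k2 : supported_in K psi by apply: hK => /=; tauto.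
by rewrite (aE uK k1 k2) (aE uK k2 k1) finite_formC.
Qed.

Lemma form_linl c phi psi chi : finitely_supported phi ->
  finitely_supported psi -> finitely_supported chi ->
  a (fun x => c * phi x + psi x) chi = c * a phi chi + a psi chi.
Proof.
move=> h1 h2 h3.
have [|K [uK _ hK]] := @common_support _ _ [:: phi; psi; chi] [::].
  by move=> ? [<-|[<-|[<-|[]]]].
have [k1 [k2 k3]] : supported_in K phi /\ supported_in K psi /\ supported_in K chi.
  by split; [|split]; apply: hK => /=; tauto.
by rewrite !(aE uK)// ?finite_form_lin//; exact: supported_lin.
Qed.

Lemma formBl phi psi chi : finitely_supported phi ->
  finitely_supported psi -> finitely_supported chi ->
  a (fun x => phi x - psi x) chi = a phi chi - a psi chi.
Proof.
move=> h1 h2 h3; have := form_linl (-1) h2 h1 h3.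
rewrite mulN1r addrC => <-; congr a; apply/funext => x.
by rewrite mulN1r addrC.
Qed.

Lemma formBr phi psi chi : finitely_supported phi ->
  finitely_supported psi -> finitely_supported chi ->
  a chi (fun x => phi x - psi x) = a chi phi - a chi psi.
Proof.
move=> h1 h2 h3; rewrite formC ?formBl//; last exact: finitely_supportedB.
by rewrite !(formC h3).
Qed.

Lemma formB_sqr phi psi : finitely_supported phi -> finitely_supported psi ->
  a (fun x => phi x - psi x) (fun x => phi x - psi x) =
  a phi phi - 2 * a phi psi + a psi psi.
Proof.
move=> h1 h2; have h := finitely_supportedB h1 h2.
by rewrite formBl// !formBr// (formC h2 h1); ring.
Qed.

Lemma formZ_sqr c phi : finitely_supported phi ->
  a (fun x => c * phi x) (fun x => c * phi x) = c ^+ 2 * a phi phi.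
Proof.
move=> h1.
have /finitely_supportedP[K uK hK] := h1.
have hc : supported_in K (fun x => c * phi x) by move=> x /hK ->; rewrite mulr0.
rewrite !(aE uK)// /finite_form mulrBr !mulr_sumr; congr (_ - _).
  by apply: eq_bigr => x _; ring.
apply: eq_bigr => x _; rewrite mulr_sumr; apply: eq_bigr => y _; ring.
Qed.

Lemma form_lin_sqr (t : R) phi psi : finitely_supported phi ->
  finitely_supported psi ->
  a (fun x => t * psi x + phi x) (fun x => t * psi x + phi x) =
  a phi phi + 2 * t * a phi psi + t ^+ 2 * a psi psi.
Proof.
move=> h1 h2; have h := finitely_supported_lin t h2 h1.
rewrite form_linl// (formC h2 h) (formC h1 h) !form_linl// (formC h2 h1); ring.
Qed.

Lemma form_cauchy_schwarz phi psi : finitely_supported phi ->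
  finitely_supported psi -> a phi psi ^+ 2 <= a phi phi * a psi psi.
Proof.
move=> h1 h2; apply: discriminant_le => [|t]; first exact: a_ge0.
by rewrite -form_lin_sqr//; apply/a_ge0/finitely_supported_lin.
Qed.

Lemma formB_le phi psi : finitely_supported phi -> finitely_supported psi ->
  a (fun x => phi x - psi x) (fun x => phi x - psi x) <=
  2 * a phi phi + 2 * a psi psi.
Proof.
move=> h1 h2.
have := a_ge0 (finitely_supported_lin 1 h2 h1); rewrite form_lin_sqr//.
by rewrite formB_sqr//; lra.
Qed.

Lemma form_le_diff phi psi : finitely_supported phi -> finitely_supported psi ->
  a phi phi <=
  2 * a (fun x => phi x - psi x) (fun x => phi x - psi x) + 2 * a psi psi.
Proof.
move=> h1 h2.
have := a_ge0 (finitely_supported_lin (-2) h2 h1); rewrite form_lin_sqr//.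
by rewrite formB_sqr//; lra.
Qed.

(** The formal Schroedinger operator on C_c(X). *)
Definition form_op phi x : R := V x * phi x - tsum (fun y => b x y * phi y).

Lemma form_opE K phi x : uniq K -> supported_in K phi ->
  form_op phi x = V x * phi x - \sum_(y <- K) b x y * phi y.
Proof.
move=> uK hK; congr (_ - _); apply/has_sum_tsum/has_sum_fin => // y /hK ->.
by rewrite mulr0.
Qed.

(** A summable nonnegative family is bounded, hence square summable. *)
Lemma graph_column_l2 y : l2 (fun x => b x y).
Proof.
have /abs_summableP[M hM] := graph_summable graph_b y.
have bM x : b x y <= M.
  have := hM [:: x] isT; rewrite big_seq1 (graph_sym graph_b).
  by move=> /(le_trans (ler_norm _)).
apply/l2P/abs_summableP; exists (M * M) => B uB.
have M0 : 0 <= M by apply: le_trans (bM y); exact: graph_ge0 graph_b _ _.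
apply: (@le_trans _ _ (M * \sum_(x <- B) `|b y x|)); last by rewrite ler_wpM2l// hM.
rewrite mulr_sumr; apply: ler_sum => x _.
rewrite (graph_sym graph_b) ger0_norm ?sqr_ge0// (graph_sym graph_b y).
rewrite ger0_norm ?(graph_ge0 graph_b)// expr2 ler_wpM2r// ?(graph_ge0 graph_b)//.
Qed.

Lemma form_op_l2 phi : finitely_supported phi -> l2 (form_op phi).
Proof.
move=> /finitely_supportedP[K uK hK].
have -> : form_op phi = fun x => V x * phi x - \sum_(y <- K) b x y * phi y.
  by apply/funext => x; rewrite (form_opE _ uK hK).
apply: l2B.
  apply: l2_finitely_supported; apply/finitely_supportedP; exists K => //.
  by move=> x /hK ->; rewrite mulr0.
elim: K {uK hK} => [|y K IH].
  have := @l20 R X; congr l2; apply/funext => x; by rewrite big_nil.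
have := l2_lin (phi y) (graph_column_l2 y) IH; congr l2; apply/funext => x.
by rewrite big_cons mulrC.
Qed.

Lemma form_op_inner phi psi : finitely_supported phi -> finitely_supported psi ->
  a phi psi = l2inner (form_op phi) psi.
Proof.
move=> h1 h2; have [|K [uK _ hK]] := @common_support _ _ [:: phi; psi] [::].
  by move=> chi [<-|[<-|[]]].
have k1 : supported_in K phi by apply: hK => /=; tauto.
have k2 : supported_in K psi by apply: hK => /=; tauto.
rewrite (aE uK)// (l2inner_fin _ uK)// finite_formC /finite_form -sumrB.
apply: eq_bigr => x _; rewrite (form_opE _ uK k1) mulrBl mulr_suml.
by congr (_ - _); [ring|apply: eq_bigr => y _; ring].
Qed.

(** For a sequence d_n that is Cauchy for a and tends to 0 in l^2(X), expand
    a(d_n - d_N): it is small, whereas the mixed term a(d_n, d_N) is the inner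
    product of d_n with a fixed function of l^2(X), and tends to 0. *)
Lemma form_closable (phi phi' : nat -> X -> R) f : l2 f ->
  form_approx a phi f -> form_approx a phi' f ->
  forall e : R, 0 < e -> exists N, forall n, (N <= n)%N ->
    a (fun x => phi n x - phi' n x) (fun x => phi n x - phi' n x) <= e.
Proof.
move=> lf [fs /cvg_seqP cv ca] [fs' /cvg_seqP cv' ca'] e e0.
pose d n x := phi n x - phi' n x.
have fd n : finitely_supported (d n) by exact: finitely_supportedB.
have e8 : 0 < e / 8 by rewrite divr_gt0.
have [N1 hN1] := ca _ e8; have [N2 hN2] := ca' _ e8.
pose N := maxn N1 N2.
pose C := l2norm (form_op (d N)).
have C0 : 0 <= C by exact: sqrtr_ge0.
have eC : 0 < e / (8 * (C + 1)) by rewrite divr_gt0// mulr_gt0// ltr_wpDl.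
have [N3 hN3] := cv _ eC; have [N4 hN4] := cv' _ eC.
exists (maxn N (maxn N3 N4)) => n; rewrite !geq_max => /and3P[/andP[n1 n2] n3 n4].
rewrite -/(d n).
have h1 : a (fun x => d n x - d N x) (fun x => d n x - d N x) <= e / 2.
  have -> : (fun x => d n x - d N x) =
      (fun x => (phi n x - phi N x) - (phi' n x - phi' N x)).
    by apply/funext => x; rewrite /d; ring.
  apply: (le_trans (formB_le (finitely_supportedB _ _) (finitely_supportedB _ _))) => //.
  have := hN1 n N n1 (leq_maxl _ _); have := hN2 n N n2 (leq_maxr _ _); lra.
have dn : l2norm (d n) <= 2 * (e / (8 * (C + 1))).
  have -> : d n = (fun x => (phi n x - f x) + (-1) * (phi' n x - f x)).
    by apply/funext => x; rewrite /d; ring.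
  have l1 := l2B (l2_finitely_supported (fs n)) lf.
  have l1' := l2B (l2_finitely_supported (fs' n)) lf.
  apply: (le_trans (l2normD l1 (l2Z (-1) l1'))).
  rewrite l2normZ// normrN1 mul1r.
  have := hN3 n n3; have := hN4 n n4; rewrite !subr0.
  rewrite !ger0_norm ?sqrtr_ge0//; lra.
have h2 : a (d n) (d N) <= e / 4.
  rewrite formC// form_op_inner//.
  apply: (le_trans (ler_norm _)).
  apply: (le_trans (l2inner_abs_le (form_op_l2 (fd N)) (l2_finitely_supported (fd n)))).
  apply: (@le_trans _ _ ((C + 1) * (2 * (e / (8 * (C + 1)))))).
    by rewrite ler_pM// ?sqrtr_ge0// lerDl.
  by rewrite le_eqVlt; apply/orP; left; apply/eqP; field; lra.
have := a_ge0 (fd N); move: h1; rewrite formB_sqr//; lra.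
Qed.

Lemma form_approx_bounded (phi : nat -> X -> R) f : form_approx a phi f ->
  exists C N, 0 <= C /\ forall n, (N <= n)%N -> a (phi n) (phi n) <= C.
Proof.
move=> [fs _ ca]; have [N hN] := ca _ ltr01.
exists (2 + 2 * a (phi N) (phi N)), N; split.
  by rewrite addr_ge0// mulr_ge0// a_ge0.
move=> n Nn; apply: (le_trans (form_le_diff (fs n) (fs N))).
have := hN n N Nn (leqnn _); lra.
Qed.

(** By closability, the limit of a(phi_n, psi_n) does not depend on the
    approximating sequences. *)
Lemma form_approx_gap (phi phi' psi psi' : nat -> X -> R) f v : l2 f -> l2 v ->
  form_approx a phi f -> form_approx a phi' f ->
  form_approx a psi v -> form_approx a psi' v ->
  forall e : R, 0 < e -> exists N, forall n, (N <= n)%N ->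
    `|a (phi n) (psi n) - a (phi' n) (psi' n)| <= e.
Proof.
move=> lf lv hphi hphi' hpsi hpsi' e e0.
have [C [N1 [C0 hC]]] := form_approx_bounded hpsi.
have [C' [N2 [C'0 hC']]] := form_approx_bounded hphi'.
have e2 : 0 < (e / 2) ^+ 2 by rewrite exprn_gt0// divr_gt0.
have [N3 hN3] := form_closable lf hphi hphi' (divr_gt0 e2 (ltr_wpDl C0 ltr01)).
have [N4 hN4] := form_closable lv hpsi hpsi' (divr_gt0 e2 (ltr_wpDl C'0 ltr01)).
exists (maxn (maxn N1 N2) (maxn N3 N4)) => n.
rewrite !geq_max => /andP[/andP[n1 n2] /andP[n3 n4]].
case: hphi hphi' hpsi hpsi' => [fs _ _] [fs' _ _] [gs _ _] [gs' _ _].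
have -> : a (phi n) (psi n) - a (phi' n) (psi' n) =
    a (fun x => phi n x - phi' n x) (psi n) +
    a (phi' n) (fun x => psi n x - psi' n x).
  by rewrite formBl// formBr//; ring.
have key (x y c : R) : 0 <= c -> 0 <= x -> x <= (e / 2) ^+ 2 / (c + 1) ->
    y <= c -> 0 <= y -> x * y <= (e / 2) ^+ 2.
  move=> c0 x0 xc yc y0.
  apply: (@le_trans _ _ ((e / 2) ^+ 2 / (c + 1) * (c + 1))).
    by rewrite ler_pM// (le_trans yc)// lerDl.
  by rewrite divfK// gt_eqF// ltr_wpDl.
have sq (x : R) : x ^+ 2 <= (e / 2) ^+ 2 -> `|x| <= e / 2.
  move=> h; rewrite -(@ler_pXn2r _ 2)// ?nnegrE// ?divr_ge0 ?(ltW e0)//.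
  by rewrite real_normK ?num_real.
rewrite (le_trans (ler_normD _ _))// (splitr e) lerD//; apply: sq.
  apply: (le_trans (form_cauchy_schwarz (finitely_supportedB _ _) _)) => //.
  apply: (key _ _ C) => //; [apply/a_ge0/finitely_supportedB|exact: hN3|exact: hC|exact: a_ge0] => //.
apply: (le_trans (form_cauchy_schwarz _ (finitely_supportedB _ _))) => //.
rewrite mulrC.
apply: (key _ _ C') => //; [apply/a_ge0/finitely_supportedB|exact: hN4|exact: hC'|exact: a_ge0] => //.
Qed.

Lemma cvg_gap_unique (u v : nat -> R) (c c' : R) :
  u n @[n --> \oo] --> c -> v n @[n --> \oo] --> c' ->
  (forall e : R, 0 < e -> exists N, forall n, (N <= n)%N -> `|u n - v n| <= e) ->
  c = c'.
Proof.
move=> /cvg_seqP uc /cvg_seqP vc h.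
apply/eqP; rewrite -subr_eq0 -normr_le0; apply/ler_addgt0Pr => e e0.
have e3 : 0 < e / 3 by rewrite divr_gt0.
have [N1 h1] := uc _ e3; have [N2 h2] := vc _ e3; have [N3 h3] := h _ e3.
pose n := maxn N1 (maxn N2 N3).
have := h1 n (leq_maxl _ _).
have := h2 n (leq_trans (leq_maxl _ _) (leq_maxr _ _)).
have := h3 n (leq_trans (leq_maxr _ _) (leq_maxr _ _)).
rewrite add0r !ler_norml => /andP[a1 a2] /andP[a3 a4] /andP[a5 a6].
apply/andP; split; lra.
Qed.

Lemma form_operator_sym f g f' g' : form_operator a f g ->
  form_operator a f' g' -> l2inner g f' = l2inner f g'.
Proof.
move=> [df lg hf] [df' lg' hf'].
have [phi [psi [h1 h2 c1]]] := hf _ df'.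
have [phi' [psi' [h3 h4 c2]]] := hf' _ df.
case: df df' => lf _ [lf' _].
rewrite [RHS]l2innerC; apply: (cvg_gap_unique c1 c2) => e e0.
have [N hN] := form_approx_gap lf lf' h1 h4 h2 h3 e0.
exists N => n /hN; rewrite (formC (phi := psi' n))//.
  by case: h4.
by case: h3.
Qed.

(** An upper bound over C_c(X) passes to the domain of A, as <A f, f> is the
    limit of a(phi_n, phi_n) along sequences that approximate f. *)
Lemma form_operator_bound f0 (M : R) f g : l2 f0 ->
  (forall phi, finitely_supported phi -> 2 * l2inner f0 phi - a phi phi <= M) ->
  form_operator a f g -> 2 * l2inner f0 f - l2inner g f <= M.
Proof.
move=> lf0 hM [df lg hf]; have [phi [psi [h1 h2 c1]]] := hf _ df.
have [lf _] := df.
apply/ler_addgt0Pr => e e0.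
have e4 : 0 < e / 4 by rewrite divr_gt0.
have [N1 hN1] := form_approx_gap lf lf h1 h1 h2 h1 e4.
move/cvg_seqP : c1 => c1; have [N2 hN2] := c1 _ e4.
have [fs /cvg_seqP cv _] := h1.
have n1 : 0 < l2norm f0 + 1 by rewrite ltr_wpDl// sqrtr_ge0.
have [N3 hN3] := cv _ (divr_gt0 e4 n1).
pose n := maxn N1 (maxn N2 N3).
have := hN1 n (leq_maxl _ _).
have := hN2 n (leq_trans (leq_maxl _ _) (leq_maxr _ _)).
have := hN3 n (leq_trans (leq_maxr _ _) (leq_maxr _ _)).
rewrite subr0 (ger0_norm (sqrtr_ge0 _)) => k1.
have lp := l2_finitely_supported (fs n).
have k2 : `|l2inner f0 (phi n) - l2inner f0 f| <= e / 4.
  have -> : l2inner f0 (phi n) - l2inner f0 f = l2inner f0 (fun x => phi n x - f x).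
    by rewrite l2innerBr.
  apply: (le_trans (l2inner_abs_le lf0 (l2B lp lf))).
  apply: (@le_trans _ _ ((l2norm f0 + 1) * (e / 4 / (l2norm f0 + 1)))).
    by rewrite ler_pM// ?sqrtr_ge0// lerDl.
  by rewrite mulrC divfK// gt_eqF.
move: k2; have := hM _ (fs n).
rewrite !ler_norml => a0 /andP[a1 a2] /andP[a3 a4] /andP[a5 a6]; lra.
Qed.

Lemma form_approx_cst phi : finitely_supported phi ->
  form_approx a (fun=> phi) phi.
Proof.
have z : (fun x => phi x - phi x) = (fun x => 0 * phi x).
  by apply/funext => x; rewrite subrr mul0r.
move=> fs; split => //.
  rewrite z; under eq_fun do rewrite (l2normZ 0 (l2_finitely_supported fs)) normr0 mul0r.
  exact: cvg_cst.
move=> e e0; exists 0%N => m n _ _.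
by rewrite z formZ_sqr// expr0n mul0r.
Qed.

(** C_c(X) is contained in the domain of A because the columns of b are square
    summable. *)
Lemma form_operator_fin phi : finitely_supported phi ->
  form_operator a phi (form_op phi).
Proof.
move=> fs; split; first by split; [exact: l2_finitely_supported|
  exists (fun=> phi); exact: form_approx_cst].
  exact: form_op_l2.
move=> v [lv [psi hpsi]]; exists (fun=> phi), psi; split => //.
  exact: form_approx_cst.
have [gs /cvg_seqP cv _] := hpsi.
apply/cvg_seqP => e e0.
have lo := form_op_l2 fs.
have n1 : 0 < l2norm (form_op phi) + 1 by rewrite ltr_wpDl// sqrtr_ge0.
have [N hN] := cv _ (divr_gt0 e0 n1); exists N => n /hN.
rewrite subr0 (ger0_norm (sqrtr_ge0 _)) => k1.
rewrite form_op_inner//.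
have lp := l2_finitely_supported (gs n).
have -> : l2inner (form_op phi) (psi n) - l2inner (form_op phi) v =
    l2inner (form_op phi) (fun x => psi n x - v x).
  by rewrite l2innerBr.
apply: (le_trans (l2inner_abs_le lo (l2B lp lv))).
apply: (@le_trans _ _ ((l2norm (form_op phi) + 1) * (e / (l2norm (form_op phi) + 1)))).
  by rewrite ler_pM// ?sqrtr_ge0// lerDl.
by rewrite mulrC divfK// gt_eqF.
Qed.

End form_theory.

(** * The variational formula for the Green function *)

Lemma cvg_at_right0P (R : realType) (u : R -> R) (l : R) :
  u t @[t --> 0^'+] --> l <->
  forall e : R, 0 < e ->
    exists2 d : R, 0 < d & forall t, 0 < t < d -> `|u t - l| <= e.
Proof.
split=> [/cvgrPdist_le h e e0|h].
  have [d /= d0 hd] := h _ e0; exists d => // t /andP[t0 td].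
  by rewrite distrC; apply: hd => //=; rewrite sub0r normrN gtr0_norm.
apply/cvgrPdist_le => e /h[d d0 hd]; exists d => //= t /=.
rewrite sub0r normrN => td t0; rewrite distrC; apply: hd.
by rewrite t0 -(gtr0_norm t0).
Qed.

Section green.
Variables (R : realType) (X : choiceType) (b : X -> X -> R) (V : X -> R).
Hypothesis graph_b : is_graph b.
Variable a : (X -> R) -> (X -> R) -> R.
Hypothesis aE : forall K phi psi, uniq K -> supported_in K phi ->
  supported_in K psi -> a phi psi = finite_form b V K phi psi.
Hypothesis a_ge0 : forall phi, finitely_supported phi -> 0 <= a phi phi.
Hypothesis a_coercive : forall f : X -> R, finitely_supported f ->
  exists M : R, forall phi, finitely_supported phi ->
    2 * l2inner f phi - a phi phi <= M.
Local Notation E := (ell2 R X).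

Section semigroup_transfer.
Variable S : R -> (X -> R) -> X -> R.
Hypothesis HS : is_semigroup (form_operator a) S.

(** The semigroup on the type [ell2]; the value at negative times is arbitrary. *)
Definition ell2_semigroup (t : R) (f : E) : E :=
  match pselect (0 <= t) with
  | left t0 => Ell2 (semigroup_l2 HS t0 (ell2P f))
  | right _ => 0
  end.

Lemma liftE t (f : E) : 0 <= t -> ell2_semigroup t f = S t f :> (X -> R).
Proof. by move=> t0; rewrite /ell2_semigroup; case: pselect. Qed.

Lemma ell2_semigroup_lin t : 0 <= t -> linear (ell2_semigroup t).
Proof.
move=> t0 c f g; apply: ell2_ext => x.
rewrite ell2DE ell2ZE !liftE//.
exact: (semigroup_linear HS c t0 (ell2P f) (ell2P g)).
Qed.

Lemma ell2_semigroup_bdd t : 0 <= t -> exists C : R, forall f : E, `|ell2_semigroup t f| <= C * `|f|.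
Proof.
move=> t0; have [C hC] := semigroup_bounded HS t0; exists C => f.
by rewrite !ell2_normE liftE// hC//; exact: ell2P.
Qed.

Lemma ell2_semigroup_0 f : ell2_semigroup 0 f = f.
Proof.
by apply: ell2_ext => x; rewrite liftE// (semigroup_0 HS)//; exact: ell2P.
Qed.

Lemma ell2_semigroup_D (s t : R) f : 0 <= s -> 0 <= t -> ell2_semigroup (s + t) f = ell2_semigroup s (ell2_semigroup t f).
Proof.
move=> s0 t0; apply: ell2_ext => x.
by rewrite !liftE// ?addr_ge0// (semigroup_D HS)//; exact: ell2P.
Qed.

Lemma ell2_semigroup_cont f (e : R) : 0 < e ->
  exists2 d : R, 0 < d & forall t : R, 0 < t < d -> `|ell2_semigroup t f - f| <= e.
Proof.
move=> e0; have /cvg_at_right0P/(_ _ e0)[d d0 hd] :=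
  semigroup_continuous HS (ell2P f).
exists d => // t td; have := hd t td; rewrite subr0.
rewrite ger0_norm ?sqrtr_ge0// ell2_normE.
have /andP[t0 _] := td.
rewrite (_ : (fun x => S t f x - f x) = ell2_semigroup t f - f)//.
by apply/funext => x; rewrite ell2BE liftE// ltW.
Qed.

Lemma ell2_semigroup_generates (f g : E) : generates ell2_semigroup f g <-> form_operator a f g.
Proof.
have nE t : 0 < t -> `|t^-1 *: (f - ell2_semigroup t f) - g| =
    l2norm (fun x => (f x - S t f x) / t - g x).
  move=> t0; rewrite ell2_normE; congr l2norm; apply/funext => x.
  by rewrite ell2BE ell2ZE ell2BE liftE ?ltW// mulrC.
rewrite (semigroup_generator HS (ell2P f) (ell2P g)).
split=> [h|/cvg_at_right0P h].
  apply/cvg_at_right0P => e /h[d d0 hd]; exists d => // t td.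
  have /andP[t0 _] := td.
  by rewrite subr0 ger0_norm ?sqrtr_ge0// -nE// hd.
move=> e /h[d d0 hd]; exists d => // t td.
have /andP[t0 _] := td.
by have := hd t td; rewrite subr0 ger0_norm ?sqrtr_ge0// -nE.
Qed.

Lemma ell2_semigroup_sym f g f' g' : generates ell2_semigroup f g -> generates ell2_semigroup f' g' ->
  ell2_ip g f' = ell2_ip f g'.
Proof.
by move=> /ell2_semigroup_generates h1 /ell2_semigroup_generates h2; exact: (form_operator_sym graph_b aE a_ge0 h1 h2).
Qed.

Lemma ell2_semigroup_bound (f : E) (M : R) :
  (forall phi, finitely_supported phi -> 2 * l2inner f phi - a phi phi <= M) ->
  forall h k, generates ell2_semigroup h k -> 2 * ell2_ip f h - ell2_ip k h <= M.
Proof.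
move=> hM h k /ell2_semigroup_generates hk.
exact: (form_operator_bound graph_b aE a_ge0 (ell2P f) hM hk).
Qed.

Lemma ell2_semigroup_ge0 f g : generates ell2_semigroup f g -> 0 <= ell2_ip g f.
Proof.
move=> fg; have := @ell2_semigroup_bound 0 0 _ _ _ fg.
rewrite (ip0l (@ell2_ip_linl R X)) mulr0 sub0r oppr_le0; apply.
move=> phi fs; rewrite (_ : l2inner _ phi = 0) ?mulr0 ?sub0r ?oppr_le0 ?a_ge0//.
by apply: has_sum_tsum; apply: eq_has_sum (@has_sum0 R X) => x; rewrite /= mul0r.
Qed.

End semigroup_transfer.

Lemma finitely_supported_indic1 x : finitely_supported (\1_[set x] : X -> R).
Proof.
apply/finitely_supportedP; exists [:: x] => // y; rewrite inE indicE.
by rewrite in_set1 => /negbTE ->.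
Qed.

Lemma l2inner_indic1 (f : X -> R) x : l2inner f \1_[set x] = f x.
Proof.
rewrite (l2inner_fin (K := [:: x]))//; last first.
  by move=> y; rewrite inE indicE in_set1 => /negbTE ->.
by rewrite big_seq1 indicE in_set1 eqxx mulr1.
Qed.

(** Coercivity makes Q finite on C_c(X), and C_c(X) serves both as the core on
    which Q is evaluated and as the set of test functions. *)
Theorem green_variational (g : X -> X -> \bar R) : is_green a g ->
  exists Q : (X -> R) -> R, [/\
    forall f (M : R), finitely_supported f ->
      (forall phi, finitely_supported phi ->
         2 * l2inner f phi - a phi phi <= M) -> Q f <= M,
    forall f phi, finitely_supported f -> finitely_supported phi ->
      2 * l2inner f phi - a phi phi <= Q f &
    forall x x0, g x x0 = (4^-1 *
      (Q (fun y => \1_[set x0] y + \1_[set x] y)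
       - Q (fun y => \1_[set x0] y - \1_[set x] y)))%:E].
Proof.
move=> [S [HS gE]].
pose T := ell2_semigroup HS.
pose D : set E := [set f : E | finitely_supported f].
pose op (f : E) : E :=
  match pselect (finitely_supported f) with
  | left fs => Ell2 (form_op_l2 V graph_b fs)
  | right _ => 0
  end.
have opE (f : E) : D f -> op f = form_op b V f :> (X -> R).
  by move=> Df; rewrite /op; case: pselect.
have Dgen f : D f -> generates T f (op f).
  by move=> Df; apply/ell2_semigroup_generates; rewrite opE//; exact: form_operator_fin.
have Dlin c f h : D f -> D h -> D (c *: f + h).
  by move=> Df Dh; exact: finitely_supported_lin.
have Dbnd f : D f -> exists M : R,
    forall h k, generates T h k -> 2 * ell2_ip f h - ell2_ip k h <= M.
  by move=> Df; have [M hM] := a_coercive Df; exists M; exact: ell2_semigroup_bound.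
have [Q [Qle Qge QE]] := potential_variational (@ell2_ipC R X)
  (@ell2_ip_linl R X) (@ell2_ip_norm R X) (@ell2_semigroup_lin _ HS)
  (@ell2_semigroup_bdd _ HS) (ell2_semigroup_0 HS) (@ell2_semigroup_D _ HS) (@ell2_semigroup_cont _ HS)
  (@ell2_semigroup_sym _ HS) (@ell2_semigroup_ge0 _ HS) Dgen Dlin Dbnd.
pose mk (f : X -> R) : E :=
  match pselect (finitely_supported f) with
  | left fs => Ell2 (l2_finitely_supported fs)
  | right _ => 0
  end.
have mkE f : finitely_supported f -> mk f = f :> (X -> R).
  by move=> fs; rewrite /mk; case: pselect.
have Dmk f : finitely_supported f -> D (mk f).
  by move=> fs; rewrite /D /= mkE.
exists (fun f => Q (mk f)); split.
- move=> f M fs hM; apply: (Qle _ _ (Dmk _ fs)).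
  by apply: ell2_semigroup_bound; rewrite mkE.
- move=> f phi fs fphi.
  have := Qge _ _ (Dmk _ fs) (Dmk _ fphi).
  rewrite /ell2_ip opE ?mkE//; last exact: Dmk.
  by rewrite -(form_op_inner graph_b aE fphi fphi).
move=> x x0; rewrite gE.
have fx := finitely_supported_indic1 x; have fx0 := finitely_supported_indic1 x0.
have := QE _ _ (Dmk _ fx0) (Dmk _ fx).
rewrite (_ : mk \1_[set x0] + mk \1_[set x] =
    mk (fun y => \1_[set x0] y + \1_[set x] y)); last first.
  apply: ell2_ext => y; rewrite ell2DE !mkE//.
  have := finitely_supported_lin 1 fx0 fx; congr finitely_supported.
  by apply/funext => z; rewrite mul1r.
rewrite (_ : mk \1_[set x0] - mk \1_[set x] =
    mk (fun y => \1_[set x0] y - \1_[set x] y)); last first.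
  by apply: ell2_ext => y; rewrite ell2BE !mkE//; exact: finitely_supportedB.
move=> <-; apply: eq_integral => t; rewrite inE/= in_itv/= andbT => t0.
congr EFin; rewrite /ell2_ip mkE// l2inner_indic1 /T liftE//.
by rewrite mkE.
Qed.

End green.

(** * Graphs, supersolutions and the ground state transform *)

Section graph.
Variables (R : realType) (X : choiceType) (b : X -> X -> R) (q : X -> R).
Hypothesis graph_b : is_graph b.
Implicit Types (phi psi f u : X -> R) (K : seq X).

Definition vertex_weight x : R := tsum (b x) + q x.

Lemma degree_has_sum x : has_sum (b x) (tsum (b x)).
Proof. exact: abs_summable_has_sum (graph_summable graph_b x). Qed.

Lemma has_sum_fst k (g : X -> R) s : has_sum g s ->
  has_sum (fun p : X * X => if p.1 == k then g p.2 else 0) s.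
Proof.
apply: (@has_sum_embed _ _ _ (fun y => (k, y)) snd) => //=.
  by move=> y; rewrite eqxx.
by move=> [x y] /=; rewrite xpair_eqE eqxx andbT eq_sym => /negbTE ->.
Qed.

Lemma has_sum_snd k (g : X -> R) s : has_sum g s ->
  has_sum (fun p : X * X => if p.2 == k then g p.1 else 0) s.
Proof.
apply: (@has_sum_embed _ _ _ (fun y => (y, k)) fst) => //=.
  by move=> y; rewrite eqxx.
by move=> [x y] /=; rewrite xpair_eqE eqxx /= eq_sym => /negbTE ->.
Qed.

Lemma sum_pick K (c : X -> R) (x : X) : uniq K ->
  \sum_(k <- K) (if x == k then c k else 0) = if x \in K then c x else 0.
Proof.
move=> uK; have [xK|xK] := boolP (x \in K).
  rewrite (bigD1_seq x)//= eqxx big1 ?addr0// => k; rewrite eq_sym => /negbTE ->//.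
rewrite big_seq big1// => k kK; case: eqP => // xk.
by rewrite xk kK in xK.
Qed.

(** The function of pairs defining the form is not finitely supported: the
    terms phi(x) psi(x) and phi(y) psi(y) are summed over all neighbours, and
    produce the weighted degree. *)
Lemma schrodinger_form_finite K phi psi : uniq K -> supported_in K phi ->
  supported_in K psi ->
  schrodinger_form b q phi psi = finite_form b vertex_weight K phi psi.
Proof.
move=> uK kphi kpsi.
pose S1 := \sum_(k <- K) phi k * psi k * tsum (b k).
pose S2 := \sum_(k <- K) phi k * \sum_(l <- K) b k l * psi l.
pose S3 := \sum_(k <- K) psi k * \sum_(l <- K) b k l * phi l.
have pick (c g : X -> R) x : supported_in K g ->
    \sum_(k <- K) (if x == k then g k * c k else 0) = g x * c x.
  by move=> sg; rewrite sum_pick//; case: ifPn => // /sg ->; rewrite mul0r.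
have h1 : has_sum (fun p : X * X => b p.1 p.2 * phi p.1 * psi p.1) S1.
  have := @has_sum_sum R _ _ K _ _ (fun k => has_sumZ (phi k * psi k)
    (has_sum_fst k (degree_has_sum k))).
  apply: eq_has_sum => p.
  have -> : \sum_(k <- K) phi k * psi k * (if p.1 == k then b k p.2 else 0) =
      \sum_(k <- K) (if p.1 == k then phi k * (psi k * b k p.2) else 0).
    by apply: eq_bigr => k _; case: ifP => _; ring.
  by rewrite (pick (fun k => psi k * b k p.2) phi)//; ring.
have h2 : has_sum (fun p : X * X => b p.1 p.2 * phi p.2 * psi p.2) S1.
  have := @has_sum_sum R _ _ K _ _ (fun k => has_sumZ (phi k * psi k)
    (has_sum_snd k (degree_has_sum k))).
  apply: eq_has_sum => p.
  have -> : \sum_(k <- K) phi k * psi k * (if p.2 == k then b k p.1 else 0) =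
      \sum_(k <- K) (if p.2 == k then phi k * (psi k * b k p.1) else 0).
    by apply: eq_bigr => k _; case: ifP => _; ring.
  rewrite (pick (fun k => psi k * b k p.1) phi)// (graph_sym graph_b p.2); ring.
have fin g k : supported_in K g ->
    has_sum (fun y => b k y * g y) (\sum_(l <- K) b k l * g l).
  by move=> sg; apply: has_sum_fin => // y /sg ->; rewrite mulr0.
have h3 : has_sum (fun p : X * X => b p.1 p.2 * phi p.1 * psi p.2) S2.
  have := @has_sum_sum R _ _ K _ _ (fun k => has_sumZ (phi k)
    (has_sum_fst k (fin _ k kpsi))).
  apply: eq_has_sum => p.
  have -> : \sum_(k <- K) phi k * (if p.1 == k then b k p.2 * psi p.2 else 0) =
      \sum_(k <- K) (if p.1 == k then phi k * (b k p.2 * psi p.2) else 0).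
    by apply: eq_bigr => k _; case: ifP => _; ring.
  by rewrite (pick (fun k => b k p.2 * psi p.2) phi)//; ring.
have h4 : has_sum (fun p : X * X => b p.1 p.2 * phi p.2 * psi p.1) S3.
  have := @has_sum_sum R _ _ K _ _ (fun k => has_sumZ (psi k)
    (has_sum_fst k (fin _ k kphi))).
  apply: eq_has_sum => p.
  have -> : \sum_(k <- K) psi k * (if p.1 == k then b k p.2 * phi p.2 else 0) =
      \sum_(k <- K) (if p.1 == k then psi k * (b k p.2 * phi p.2) else 0).
    by apply: eq_bigr => k _; case: ifP => _; ring.
  by rewrite (pick (fun k => b k p.2 * phi p.2) psi)//; ring.
have S32 : S3 = S2.
  rewrite /S3 /S2; under eq_bigr do rewrite mulr_sumr.
  rewrite exchange_big /=; apply: eq_bigr => k _; rewrite mulr_sumr.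
  by apply: eq_bigr => l _; rewrite (graph_sym graph_b l); ring.
have H : has_sum (fun p : X * X =>
    b p.1 p.2 * (phi p.1 - phi p.2) * (psi p.1 - psi p.2))
    (S1 + S1 + (-1) * (S2 + S3)).
  apply: eq_has_sum (has_sumD (has_sumD h1 h2) (has_sumZ (-1) (has_sumD h3 h4))).
  by move=> p; ring.
rewrite /schrodinger_form (has_sum_tsum H).
have -> : tsum (fun x => q x * phi x * psi x) = \sum_(k <- K) q k * phi k * psi k.
  by apply/has_sum_tsum/has_sum_fin => // x /kphi ->; rewrite mulr0 mul0r.
rewrite S32 /finite_form.
have -> : \sum_(x <- K) vertex_weight x * phi x * psi x =
    S1 + \sum_(k <- K) q k * phi k * psi k.
  by rewrite -big_split /=; apply: eq_bigr => k _; rewrite /vertex_weight; ring.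
have -> : \sum_(x <- K) \sum_(y <- K) b x y * phi x * psi y = S2.
  by apply: eq_bigr => k _; rewrite mulr_sumr; apply: eq_bigr => l _; ring.
by field.
Qed.

Lemma weight_fin K (w : X -> R) phi psi : uniq K -> supported_in K phi ->
  tsum (fun x => w x * phi x * psi x) = \sum_(x <- K) w x * phi x * psi x.
Proof.
move=> uK kphi; apply/has_sum_tsum/has_sum_fin => // x /kphi ->.
by rewrite mulr0 mul0r.
Qed.

Lemma shifted_form_finite (w : X -> R) (l : R) K phi psi : uniq K ->
  supported_in K phi -> supported_in K psi ->
  shifted_form b q w l phi psi =
  finite_form b (fun x => vertex_weight x - l * w x) K phi psi.
Proof.
move=> uK kphi kpsi; rewrite /shifted_form (weight_fin _ _ uK)//.
rewrite (schrodinger_form_finite uK)// /finite_form addrAC mulr_sumr -sumrB.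
by congr (_ - _); apply: eq_bigr => x _; ring.
Qed.

Lemma formal_domain_has_sum u x : formal_domain b u ->
  has_sum (fun y => b x y * u y) (tsum (fun y => b x y * u y)).
Proof.
move=> dom; apply: abs_summable_has_sum; apply: abs_summable_dom (dom x) => y.
by rewrite !normrM normr_id.
Qed.

Lemma schrodingerE u x : formal_domain b u ->
  schrodinger b q u x = vertex_weight x * u x - tsum (fun y => b x y * u y).
Proof.
move=> dom.
have H : has_sum (fun y => b x y * (u x - u y))
    (u x * tsum (b x) + (-1) * tsum (fun y => b x y * u y)).
  apply: eq_has_sum (has_sumD (has_sumZ (u x) (degree_has_sum x))
    (has_sumZ (-1) (formal_domain_has_sum x dom))) => y; ring.
by rewrite /schrodinger (has_sum_tsum H) /vertex_weight; ring.
Qed.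

Section supersolution.
Variable u : X -> R.
Hypothesis u_super : positive_supersolution b q u.

Lemma supersolution_partial x K : uniq K ->
  \sum_(y <- K) b x y * u y <= vertex_weight x * u x.
Proof.
move=> uK; have [dom [u0 _] /(_ x)] := u_super.
rewrite schrodingerE// subr_ge0; apply: le_trans.
apply: has_sum_ge_partial (formal_domain_has_sum x dom) uK => y.
by rewrite mulr_ge0// (graph_ge0 graph_b).
Qed.

Hypothesis conn_b : graph_connected b.

(** At a zero x of u the inequality H u(x) >= 0 reads
    sum_y b(x, y) u(y) <= 0, so u vanishes at all neighbours of x; by
    connectedness u would vanish everywhere. *)
Lemma supersolution_gt0 x : 0 < u x.
Proof.
have [_ [u0 [y yu]] _] := u_super.
rewrite lt_neqAle u0 andbT eq_sym; apply/negP => /eqP ux0.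
have [s [ps ls]] := conn_b x y.
suff : u y = 0 by move/eqP; apply/negP.
rewrite -ls; elim: s x ux0 ps {ls} => [|z s IH] x ux0 //= /andP[bxz ps].
apply: IH ps; have := @supersolution_partial x [:: z] isT.
rewrite big_seq1 ux0 mulr0 => h.
apply/le_anti; rewrite u0 andbT.
by rewrite -(ler_pM2l bxz) mulr0.
Qed.

Let un0 x : u x != 0. Proof. by rewrite gt_eqF// supersolution_gt0. Qed.

(** Since 2 v(x) v(y) = v(x)^2 + v(y)^2 - (v(x) - v(y))^2, the vertex
    terms add up to (H u) u v^2, with the sum in H u restricted to K. *)
Lemma ground_state_transform K (v : X -> R) :
  finite_form b vertex_weight K (fun x => u x * v x) (fun x => u x * v x) =
  2^-1 * \sum_(x <- K) \sum_(y <- K) b x y * u x * u y * (v x - v y) ^+ 2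
  + \sum_(x <- K) (vertex_weight x * u x - \sum_(y <- K) b x y * u y) * u x * v x ^+ 2.
Proof.
pose A := \sum_(x <- K) \sum_(y <- K) b x y * u x * u y * v x ^+ 2.
pose B := \sum_(x <- K) \sum_(y <- K) b x y * u x * u y * v x * v y.
have A' : \sum_(x <- K) \sum_(y <- K) b x y * u x * u y * v y ^+ 2 = A.
  rewrite exchange_big /=; apply: eq_bigr => x _; apply: eq_bigr => y _.
  by rewrite (graph_sym graph_b); ring.
have -> : \sum_(x <- K) \sum_(y <- K) b x y * u x * u y * (v x - v y) ^+ 2 =
    A + A - 2 * B.
  rewrite -{2}A' /A /B mulr_sumr -big_split -sumrB /=.
  apply: eq_bigr => x _; rewrite mulr_sumr -big_split -sumrB /=.
  by apply: eq_bigr => y _; ring.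
have -> : \sum_(x <- K) (vertex_weight x * u x - \sum_(y <- K) b x y * u y) * u x * v x ^+ 2
   = \sum_(x <- K) vertex_weight x * (u x * v x) * (u x * v x) - A.
  rewrite /A -sumrB; apply: eq_bigr => x _.
  have -> : \sum_(y <- K) b x y * u x * u y * v x ^+ 2 =
     (\sum_(y <- K) b x y * u y) * (u x * v x ^+ 2).
    by rewrite mulr_suml; apply: eq_bigr => y _; ring.
  ring.
rewrite /finite_form.
have -> : \sum_(x <- K) \sum_(y <- K) b x y * (u x * v x) * (u y * v y) = B.
  by apply: eq_bigr => x _; apply: eq_bigr => y _; ring.
by field.
Qed.

Lemma finite_form_transform K phi :
  finite_form b vertex_weight K phi phi =
  2^-1 * \sum_(x <- K) \sum_(y <- K)
     b x y * u x * u y * (phi x / u x - phi y / u y) ^+ 2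
  + \sum_(x <- K)
     (vertex_weight x * u x - \sum_(y <- K) b x y * u y) * u x * (phi x / u x) ^+ 2.
Proof.
rewrite -ground_state_transform; congr finite_form; apply/funext => x;
by rewrite mulrC divfK.
Qed.

Let edge_ge0 x y (t : R) : 0 <= b x y * u x * u y * t ^+ 2.
Proof.
by rewrite mulr_ge0 ?sqr_ge0// !mulr_ge0 ?(graph_ge0 graph_b)// ltW// supersolution_gt0.
Qed.

Let potential_term_ge0 K x (t : R) : uniq K ->
  0 <= (vertex_weight x * u x - \sum_(y <- K) b x y * u y) * u x * t ^+ 2.
Proof.
move=> uK; rewrite mulr_ge0 ?sqr_ge0// mulr_ge0//.
  by rewrite subr_ge0 supersolution_partial.
by rewrite ltW// supersolution_gt0.
Qed.

Lemma schrodinger_form_ge0 phi : finitely_supported phi ->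
  0 <= schrodinger_form b q phi phi.
Proof.
move=> /finitely_supportedP[K uK hK].
rewrite (schrodinger_form_finite uK)// finite_form_transform; apply: addr_ge0.
  apply: mulr_ge0; first by rewrite invr_ge0.
  by apply: sumr_ge0 => x _; apply: sumr_ge0 => y _; exact: edge_ge0.
by apply: sumr_ge0 => x _; exact: potential_term_ge0.
Qed.

Lemma edge_bound x y phi : finitely_supported phi ->
  b x y * u x * u y * (phi x / u x - phi y / u y) ^+ 2 <=
  2 * schrodinger_form b q phi phi.
Proof.
move=> fs; have [|K [uK sK hK]] := @common_support _ _ [:: phi] [:: x; y].
  by move=> chi [<-|[]].
have kphi : supported_in K phi by apply: hK; left.
have xK : x \in K by apply: sK; rewrite inE eqxx.
have yK : y \in K by apply: sK; rewrite !inE eqxx orbT.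
rewrite (schrodinger_form_finite uK)// finite_form_transform.
have h1 : 0 <= \sum_(x <- K)
   (vertex_weight x * u x - \sum_(y <- K) b x y * u y) * u x * (phi x / u x) ^+ 2.
  by rewrite sumr_ge0// => z _; exact: potential_term_ge0.
have : b x y * u x * u y * (phi x / u x - phi y / u y) ^+ 2 <=
  \sum_(x <- K) \sum_(y <- K)
     b x y * u x * u y * (phi x / u x - phi y / u y) ^+ 2.
  rewrite (bigD1_seq x)//= (bigD1_seq y)//= -addrA lerDl; apply: addr_ge0.
    by apply: sumr_ge0 => z _; exact: edge_ge0.
  by apply: sumr_ge0 => z _; apply: sumr_ge0 => z' _; exact: edge_ge0.
lra.
Qed.

(** Each edge of a path contributes its own term of the ground state
    transform. *)
Lemma path_bound x y : exists2 C : R, 0 <= C &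
  forall phi, finitely_supported phi ->
    (phi x / u x - phi y / u y) ^+ 2 <= C * schrodinger_form b q phi phi.
Proof.
have [s [ps <-]] := conn_b x y.
elim: s x ps => [|z s IH] x /=.
  by exists 0 => // phi _; rewrite subrr expr0n mul0r.
move=> /andP[bxz ps]; have [C C0 hC] := IH _ ps.
pose c := b x z * u x * u z.
have c0 : 0 < c by rewrite !mulr_gt0// supersolution_gt0.
(* (p - t)^2 <= 2 (p - r)^2 + 2 (r - t)^2, and the edge gives
   (p - r)^2 <= 2 h(phi) / c. *)
exists (4 / c + 2 * C) => [|phi fs].
  by rewrite addr_ge0// ?mulr_ge0 ?invr_ge0 ?(ltW c0).
have h1 := edge_bound x z fs; have h2 := hC _ fs.
rewrite -/c mulrC -ler_pdivlMr// in h1.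
set p := phi x / u x in h1 *; set r := phi z / u z in h1 h2 *.
set t := phi _ / u _ in h2 *; set s' := schrodinger_form _ _ _ _ in h1 h2 *.
apply: (@le_trans _ _ (2 * (p - r) ^+ 2 + 2 * (r - t) ^+ 2)).
  by have := sqr_ge0 ((p - r) - (r - t)); nra.
have -> : (4 / c + 2 * C) * s' = 2 * (2 * s' / c) + 2 * (C * s') by ring.
lra.
Qed.

(** In terms of v = phi / u the truncation is v |-> min(|v|, 1), a contraction
    of R that fixes 0, so no term of the ground state transform increases. *)
Lemma truncation phi : finitely_supported phi ->
  let phi' x := Num.min `|phi x| (u x) in
  finitely_supported phi' /\
  schrodinger_form b q phi' phi' <= schrodinger_form b q phi phi.
Proof.
move=> fs phi'; have /finitely_supportedP[K uK kphi] := fs.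
have u0 x := supersolution_gt0 x.
have kphi' : supported_in K phi'.
  by move=> x /kphi; rewrite /phi' => ->; rewrite normr0 min_l// ltW.
split; first by apply/finitely_supportedP; exists K.
rewrite !(schrodinger_form_finite uK)// !finite_form_transform.
have vE x : phi' x / u x = Num.min `|phi x / u x| 1.
  rewrite normrM normfV (gtr0_norm (u0 x)) /phi' minr_pMl ?invr_ge0 ?ltW//.
  by rewrite divff.
have lip (s t : R) : (Num.min `|s| 1 - Num.min `|t| 1) ^+ 2 <= (s - t) ^+ 2.
  rewrite -(real_normK (num_real (s - t))) -(real_normK (num_real (_ - Num.min `|t| 1))).
  rewrite ler_pXn2r ?nnegrE//.
  apply: le_trans (ler_dist_dist s t).
  have := ler_norm (`|s| - `|t|); have := ler_norm (- (`|s| - `|t|)).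
  rewrite normrN ler_norml.
  by case: (leP `|s| 1) => hs; case: (leP `|t| 1) => ht h1 h2;
    apply/andP; split; lra.
have sq (t : R) : (Num.min `|t| 1) ^+ 2 <= t ^+ 2.
  have := lip t 0; rewrite normr0 (min_l ler01) !subr0; exact.
have buu x y : 0 <= b x y * u x * u y.
  by rewrite !mulr_ge0 ?(graph_ge0 graph_b)// ltW.
apply: lerD.
  rewrite ler_wpM2l ?invr_ge0//; apply: ler_sum => x _; apply: ler_sum => y _.
  by rewrite !vE ler_wpM2l.
apply: ler_sum => x _; rewrite vE ler_wpM2l//.
by rewrite mulr_ge0 ?subr_ge0 ?supersolution_partial// ltW.
Qed.

End supersolution.
End graph.

(** * Asymptotics of the variational problem *)

(** A form of 2 e <= e^2 / C + C that also covers C = 0. *)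
Lemma young_le (R : realType) (e s C : R) : 0 <= s -> 0 <= C ->
  e ^+ 2 <= C * s -> 2 * e <= s + C.
Proof.
move=> s0 C0 h; rewrite leNgt; apply/negP => h2.
have := sqr_ge0 (s - C); nra.
Qed.

Section limits.
Variables (R : realType) (X : choiceType) (b : X -> X -> R) (q w : X -> R).
Hypothesis graph_b : is_graph b.
Hypothesis conn_b : graph_connected b.
Hypothesis w_pos : positive_fun w.
Variable u : X -> R.
Hypothesis u_super : positive_supersolution b q u.
Implicit Types (phi f : X -> R) (K : seq X).

Local Notation h phi := (schrodinger_form b q phi phi).
Local Notation Wt phi := (tsum (fun x => w x * phi x * phi x)).

Let u_gt0 x : 0 < u x. Proof. exact: supersolution_gt0 u_super conn_b x. Qed.
Let h_ge0 phi : finitely_supported phi -> 0 <= h phi.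
Proof. exact: (schrodinger_form_ge0 graph_b u_super conn_b). Qed.
Let w_ge0 x : 0 <= w x. Proof. by case: w_pos. Qed.

Lemma pairing_fin K f phi : uniq K -> supported_in K f ->
  l2inner f phi = \sum_(x <- K) f x * phi x.
Proof.
move=> uK kf; rewrite l2innerC (l2inner_fin _ uK)//.
by apply: eq_bigr => x _; rewrite mulrC.
Qed.

Lemma weight_sum_ge K phi : finitely_supported phi -> uniq K ->
  \sum_(x <- K) w x * phi x ^+ 2 <= Wt phi.
Proof.
move=> /finitely_supportedP[L uL kL] uK.
have hs : has_sum (fun x => w x * phi x ^+ 2) (Wt phi).
  rewrite (weight_fin _ _ uL)//.
  apply: (eq_has_sum _ (has_sum_fin (f := fun x => w x * phi x * phi x) uL _)).
    by move=> x; ring.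
  by move=> x /kL ->; rewrite mulr0.
by apply: has_sum_ge_partial hs uK => x; rewrite mulr_ge0// sqr_ge0.
Qed.

Lemma weight_ge0 phi : finitely_supported phi -> 0 <= Wt phi.
Proof. by move=> fs; have := @weight_sum_ge [::] phi fs isT; rewrite big_nil. Qed.

Lemma sum_sqr_bound (F : X -> (X -> R) -> R) (s : (X -> R) -> R) K :
  (forall x, exists2 C : R, 0 <= C & forall phi, finitely_supported phi ->
     F x phi ^+ 2 <= C * s phi) ->
  exists2 C : R, 0 <= C & forall phi, finitely_supported phi ->
     (\sum_(x <- K) F x phi) ^+ 2 <= C * s phi.
Proof.
move=> hF; elim: K => [|x K [C C0 hC]].
  by exists 0 => // phi _; rewrite big_nil expr0n mul0r.
have [D D0 hD] := hF x; exists (2 * D + 2 * C) => [|phi fs].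
  by rewrite addr_ge0// mulr_ge0.
rewrite big_cons; have := hC _ fs; have := hD _ fs.
set p := F x phi; set r := \sum_(y <- K) _; have := sqr_ge0 (p - r); nra.
Qed.

(** Functions of small energy pair with f as if they were multiples of u. *)
Lemma pairing_gap f x1 : finitely_supported f ->
  exists2 C : R, 0 <= C & forall phi, finitely_supported phi ->
    (l2inner f phi - phi x1 / u x1 * l2inner f u) ^+ 2 <= C * h phi.
Proof.
move=> /finitely_supportedP[K uK kf].
have [|C C0 hC] := @sum_sqr_bound
  (fun x phi => f x * u x * (phi x / u x - phi x1 / u x1)) (fun phi => h phi) K.
  move=> x; have [C C0 hC] := path_bound graph_b u_super conn_b x x1.
  exists ((f x * u x) ^+ 2 * C) => [|phi fs]; first by rewrite mulr_ge0// sqr_ge0.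
  by rewrite exprMn -mulrA ler_wpM2l ?sqr_ge0// hC.
exists C => // phi fs; have := hC _ fs; congr (_ ^+ 2 <= _).
rewrite !(pairing_fin _ uK kf) mulr_sumr -sumrB; apply: eq_bigr => x _.
by field; rewrite !gt_eqF.
Qed.

Lemma weight_gap K x1 : exists2 C : R, 0 <= C &
  forall phi, finitely_supported phi ->
    \sum_(x <- K) w x * (phi x - phi x1 / u x1 * u x) ^+ 2 <= C * h phi.
Proof.
elim: K => [|x K [C C0 hC]].
  by exists 0 => // phi _; rewrite big_nil mul0r.
have [D D0 hD] := path_bound graph_b u_super conn_b x x1.
exists (w x * u x ^+ 2 * D + C) => [|phi fs].
  by rewrite addr_ge0// mulr_ge0// mulr_ge0// sqr_ge0.
rewrite big_cons mulrDl lerD ?hC//.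
rewrite (_ : phi x - phi x1 / u x1 * u x = u x * (phi x / u x - phi x1 / u x1)).
  rewrite exprMn mulrA -[leRHS]mulrA ler_wpM2l ?hD//.
  exact: mulr_ge0 (w_ge0 _) (sqr_ge0 _).
by field; rewrite !gt_eqF.
Qed.

Lemma pairing_bound f x1 (s : (X -> R) -> R) (c c' : R) : 0 <= c -> 0 <= c' ->
  finitely_supported f ->
  (forall phi, finitely_supported phi -> h phi <= c * s phi) ->
  (forall phi, finitely_supported phi -> phi x1 ^+ 2 <= c' * s phi) ->
  exists2 C : R, 0 <= C & forall phi, finitely_supported phi ->
    l2inner f phi ^+ 2 <= C * s phi.
Proof.
move=> c0 c'0 ff hs ps; have [C C0 hC] := pairing_gap x1 ff.
pose k := l2inner f u / u x1.
exists (2 * (C * c) + 2 * (k ^+ 2 * c')) => [|phi fs].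
  by rewrite addr_ge0// mulr_ge0// mulr_ge0// sqr_ge0.
have h1 : (l2inner f phi - phi x1 * k) ^+ 2 <= C * (c * s phi).
  apply: (@le_trans _ _ (C * h phi)); last by rewrite ler_wpM2l// hs.
  by have := hC _ fs; rewrite /k mulrAC mulrA.
have h2 : (phi x1 * k) ^+ 2 <= k ^+ 2 * (c' * s phi).
  by rewrite exprMn mulrC ler_wpM2l ?sqr_ge0// ps.
have := sqr_ge0 (l2inner f phi - phi x1 * k - phi x1 * k).
move: h1 h2; set p := l2inner f phi; set r := phi x1 * k; set t := s phi.
rewrite !mulrDl; nra.
Qed.

Lemma shifted_form_sqr (l : R) phi :
  shifted_form b q w l phi phi = h phi - l * Wt phi.
Proof. by []. Qed.

Lemma shifted_form_ge0 (l : R) phi : l < 0 -> finitely_supported phi ->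
  0 <= shifted_form b q w l phi phi.
Proof.
move=> l0 fs; rewrite shifted_form_sqr.
have := h_ge0 fs; have := weight_ge0 fs; nra.
Qed.

(** A vertex x1 with w(x1) > 0 controls phi(x1), and the energy propagates this
    control along paths. *)
Lemma shifted_form_coercive (l : R) f : l < 0 -> finitely_supported f ->
  exists M : R, forall phi, finitely_supported phi ->
    2 * l2inner f phi - shifted_form b q w l phi phi <= M.
Proof.
move=> l0 ff; have [_ [x1 wx1]] := w_pos.
have w1 : 0 < w x1 by rewrite lt_neqAle eq_sym wx1 w_ge0.
have lw : 0 < - l * w x1 by rewrite mulr_gt0// oppr_gt0.
have lw' : 0 <= (- l * w x1)^-1 by rewrite invr_ge0 ltW.
have [||C C0 hC] := @pairing_bound f x1
  (fun phi => shifted_form b q w l phi phi) 1 ((- l * w x1)^-1) ler01 lw' ff.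
- move=> phi fs; rewrite mul1r shifted_form_sqr.
  have := weight_ge0 fs; nra.
- move=> phi fs; rewrite mulrC ler_pdivlMr// shifted_form_sqr.
  have := @weight_sum_ge [:: x1] phi fs isT; rewrite big_seq1.
  have := h_ge0 fs; set p := phi x1 ^+ 2; nra.
exists C => phi fs; have := hC _ fs.
move/(young_le (shifted_form_ge0 l0 fs) C0); lra.
Qed.

Variable f : X -> R.
Hypothesis ff : finitely_supported f.

(** Compare phi with c u, where c = phi(x1) / u(x1).  The pairing with f changes by
    at most h(phi) / 4 + C, and the weighted mass on K satisfies
    mu sum_K w phi^2 >= mu theta c^2 n - h(phi) / 2 when mu is small.  The
    energy absorbs both errors, and the rest is a quadratic polynomial in c with
    maximum <f, u>^2 / (mu theta n). *)
Lemma variational_upper K (theta : R) : uniq K -> 0 < theta -> theta < 1 ->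
  let n := \sum_(x <- K) w x * u x ^+ 2 in 0 < n ->
  exists C mu0 : R, 0 < mu0 /\ forall mu phi, 0 < mu -> mu < mu0 ->
    finitely_supported phi ->
    2 * l2inner f phi - shifted_form b q w (- mu) phi phi <=
    l2inner f u ^+ 2 / (mu * theta * n) + C.
Proof.
move=> uK t0 t1 n n0; have [_ [x1 _]] := w_pos.
have [C C0 hC] := pairing_gap x1 ff.
have [D D0 hD] := weight_gap K x1.
have t1' : 0 < 1 - theta by rewrite subr_gt0.
(* (p + r)^2 >= theta p^2 - k r^2, the difference being a square. *)
pose k := theta / (1 - theta).
have k0 : 0 < k by rewrite divr_gt0.
have kD : 0 < 2 * k * (D + 1).
  have D1 : 0 < D + 1 by rewrite ltr_wpDl.
  by apply: mulr_gt0 => //; apply: mulr_gt0.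
exists (2 * C), (2 * k * (D + 1))^-1; split; first by rewrite invr_gt0.
move=> mu phi mu0 mu1 fs; rewrite shifted_form_sqr.
set c := phi x1 / u x1 in hC hD.
have s0 := h_ge0 fs.
have e1 : 2 * (l2inner f phi - c * l2inner f u) <= h phi / 2 + 2 * C.
  apply: young_le; rewrite ?divr_ge0 ?mulr_ge0//.
  by apply: (le_trans (hC _ fs)); rewrite -/c; lra.
have e2 : theta * c ^+ 2 * n - k * (D * h phi) <= Wt phi.
  apply: le_trans (weight_sum_ge fs uK).
  apply: (@le_trans _ _ (\sum_(x <- K) (theta * c ^+ 2 * (w x * u x ^+ 2)
     - k * (w x * (phi x - c * u x) ^+ 2)))).
    rewrite sumrB -!mulr_sumr -/n lerB// ler_wpM2l ?(ltW k0)//.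
    exact: hD.
  apply: ler_sum => x _.
  rewrite (_ : theta * c ^+ 2 * (w x * u x ^+ 2)
     - k * (w x * (phi x - c * u x) ^+ 2) =
     w x * (theta * (c * u x) ^+ 2 - k * (phi x - c * u x) ^+ 2)); last by ring.
  rewrite ler_wpM2l//.
  set p := c * u x; set r := phi x - p.
  rewrite (_ : phi x = p + r); last by rewrite /r; ring.
  rewrite -subr_ge0.
  rewrite (_ : _ - _ = ((1 - theta) * p + r) ^+ 2 / (1 - theta)).
    by rewrite divr_ge0 ?sqr_ge0// ltW.
  by rewrite /k; field; rewrite gt_eqF.
have e3 : mu * (k * (D * h phi)) <= h phi / 2.
  have : mu * (2 * k * (D + 1)) <= 1.
    by rewrite -ler_pdivlMr// mul1r ltW.
  have : 0 <= mu * k by rewrite mulr_ge0 ?(ltW mu0) ?(ltW k0).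
  move=> mk m1; have : 0 <= mu * k * h phi by rewrite mulr_ge0.
  nra.
have e4 : 2 * c * l2inner f u - mu * (theta * c ^+ 2 * n) <=
    l2inner f u ^+ 2 / (mu * theta * n).
  have m0 : 0 < mu * theta * n by rewrite !mulr_gt0.
  rewrite -subr_ge0.
  rewrite (_ : _ - _ = (l2inner f u - mu * theta * n * c) ^+ 2 / (mu * theta * n)).
    by rewrite divr_ge0 ?sqr_ge0// ltW.
  by field; rewrite !gt_eqF.
have e5 : mu * (theta * c ^+ 2 * n) - mu * (k * (D * h phi)) <= mu * Wt phi.
  by rewrite -mulrBr ler_wpM2l// ltW.
lra.
Qed.

(* [Q mu] is the supremum of the variational problem with parameter mu. *)
Variable Q : R -> R.
Hypothesis Q_le : forall mu M : R, 0 < mu ->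
  (forall phi, finitely_supported phi ->
    2 * l2inner f phi - shifted_form b q w (- mu) phi phi <= M) -> Q mu <= M.
Hypothesis Q_ge : forall (mu : R) phi, 0 < mu -> finitely_supported phi ->
  2 * l2inner f phi - shifted_form b q w (- mu) phi phi <= Q mu.

Let Q_ge0 (mu : R) : 0 < mu -> 0 <= Q mu.
Proof.
move=> mu0.
have := Q_ge mu0 (@finitely_supported0 R X).
rewrite (l2inner_fin (K := [::]))// big_nil.
rewrite (@shifted_form_finite _ _ b q graph_b w (- mu) [::])//.
by rewrite /finite_form !big_nil !subrr mulr0 subrr.
Qed.

Let scaled_limit0 : (forall e : R, 0 < e -> exists C mu0 : R, 0 < mu0 /\
    forall mu : R, 0 < mu -> mu < mu0 -> mu * Q mu <= e + mu * C) ->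
  forall e : R, 0 < e -> exists2 d : R, 0 < d &
    forall mu : R, 0 < mu -> mu < d -> `|mu * Q mu - 0| <= e.
Proof.
move=> hQ e e0; have e2 : 0 < e / 2 by rewrite divr_gt0.
have [C [mu0 [m0 hC]]] := hQ _ e2.
have C1 : 0 < `|C| + 1 by rewrite ltr_wpDl.
exists (Num.min mu0 (e / 2 / (`|C| + 1))) => [|mu mup].
  by rewrite lt_min m0 divr_gt0.
rewrite lt_min => /andP[mu1 mu2].
rewrite subr0 ger0_norm ?mulr_ge0 ?Q_ge0// ?(ltW mup)//.
apply: (le_trans (hC _ mup mu1)); rewrite [leRHS]splitr lerD2l.
apply: (@le_trans _ _ (mu * (`|C| + 1))).
  by rewrite ler_wpM2l ?(ltW mup)// (le_trans (ler_norm _))// lerDl.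
by rewrite -ler_pdivlMr// ltW.
Qed.

(** A weight w' as in the definition of subcriticality controls phi(x1) by the
    energy alone, so Q mu is bounded uniformly in mu. *)
Lemma subcritical_limit : subcritical b q ->
  forall e : R, 0 < e -> exists2 d : R, 0 < d &
    forall mu : R, 0 < mu -> mu < d -> `|mu * Q mu - 0| <= e.
Proof.
move=> [w' [[w'0 [x1 wx1]] hw']]; apply: scaled_limit0 => e e0.
have w1 : 0 < w' x1 by rewrite lt_neqAle eq_sym wx1 w'0.
have w1' : 0 <= (w' x1)^-1 by rewrite invr_ge0 ltW.
have [||C C0 hC] := @pairing_bound f x1 (fun phi => h phi) 1 ((w' x1)^-1) ler01 w1' ff.
- by move=> phi fs; rewrite mul1r.
- move=> phi fs; rewrite mulrC ler_pdivlMr//; apply: le_trans (hw' _ fs).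
  have /finitely_supportedP[K uK kK] := fs.
  have hs : has_sum (fun x => w' x * phi x ^+ 2) (\sum_(x <- K) w' x * phi x ^+ 2).
    by apply: has_sum_fin => // x /kK ->; rewrite expr0n mulr0.
  rewrite (has_sum_tsum hs).
  have := has_sum_ge_partial (B := [:: x1]) _ hs isT.
  by rewrite big_seq1 mulrC; apply => x; rewrite mulr_ge0// sqr_ge0.
exists C, 1; split => // mu mu0 _.
apply: (@le_trans _ _ (mu * C)); last by rewrite lerDr ltW.
rewrite ler_wpM2l ?(ltW mu0)//; apply: Q_le => // phi fs.
have := young_le (h_ge0 fs) C0 (hC _ fs).
rewrite shifted_form_sqr; have := weight_ge0 fs; nra.
Qed.

(** The sums n = sum_K w u^2 are unbounded, so the upper bound <f, u>^2 / (theta n)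
    for the limit can be made arbitrarily small. *)
Lemma null_critical_limit :
  ~ (\esum_(x in [set: X]) (u x ^+ 2 * w x)%:E < +oo)%E ->
  forall e : R, 0 < e -> exists2 d : R, 0 < d &
    forall mu : R, 0 < mu -> mu < d -> `|mu * Q mu - 0| <= e.
Proof.
move=> noo; apply: scaled_limit0 => e e0.
have [N N0 hN] : exists2 N : R, 0 < N & l2inner f u ^+ 2 / (2^-1 * N) <= e.
  (* The term 1 keeps N positive when <f, u> = 0. *)
  exists ((l2inner f u ^+ 2 + 1) * 2 / e).
    by rewrite divr_gt0// mulr_gt0// ltr_wpDl// sqr_ge0.
  have F1 : 0 < l2inner f u ^+ 2 + 1 by rewrite ltr_wpDl// sqr_ge0.
  rewrite (_ : 2^-1 * _ = (l2inner f u ^+ 2 + 1) / e); last by field; rewrite gt_eqF.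
  rewrite ler_pdivrMr ?divr_gt0// mulrC divfK ?gt_eqF//.
  by rewrite lerDl.
have [K uK KN] : exists2 K, uniq K & N < \sum_(x <- K) w x * u x ^+ 2.
  apply: contrapT => nK; apply: noo; apply: (@le_lt_trans _ _ N%:E); last exact: ltry.
  apply: esum_bound => [x|B uB]; first by rewrite mulr_ge0// sqr_ge0.
  rewrite leNgt; apply/negP => NB; apply: nK; exists B => //.
  by apply: (lt_le_trans NB); apply: ler_sum => x _; rewrite mulrC.
set n := \sum_(x <- K) _ in KN.
have n0 : 0 < n := lt_trans N0 KN.
have h2 : 2^-1 < 1 :> R by rewrite invf_lt1// ltr1n.
have [C [mu0 [m0 hC]]] := variational_upper uK (theta := 2^-1) ltac:(by []) h2 n0.
exists C, mu0; split => // mu mup mu1.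
have hQ := ler_wpM2l (ltW mup) (Q_le mup (fun phi fs => hC mu phi mup mu1 fs)).
apply: (le_trans hQ); rewrite mulrDr lerD2r.
apply: le_trans hN.
rewrite (_ : mu * (l2inner f u ^+ 2 / (mu * 2^-1 * n)) =
    l2inner f u ^+ 2 / (2^-1 * n)).
  apply: ler_wpM2l; first exact: sqr_ge0.
  by rewrite lef_pV2 ?posrE ?mulr_gt0 ?invr_gt0// ler_wpM2l ?invr_ge0// ltW.
by rewrite -/n; field; rewrite !gt_eqF.
Qed.

Section positive_critical_case.
Hypothesis crit : ~ subcritical b q.
Variable W : R.
Hypothesis W_sum : has_sum (fun x => w x * u x ^+ 2) W.

Lemma ground_mass_gt0 : 0 < W.
Proof.
have [_ [x1 wx1]] := w_pos.
have w1 : 0 < w x1 by rewrite lt_neqAle eq_sym wx1 w_ge0.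
have := has_sum_ge_partial (B := [:: x1]) _ W_sum isT.
rewrite big_seq1 => h1; apply: lt_le_trans (h1 _).
  by rewrite mulr_gt0// exprn_gt0.
by move=> x; rewrite mulr_ge0// sqr_ge0.
Qed.

(** Criticality, tested with small multiples of the indicator of x1, gives
    functions of energy small compared with phi(x1)^2; normalise them at x1 and
    truncate them by u. *)
Lemma null_sequence x1 (e : R) : 0 < e -> exists phi,
  [/\ finitely_supported phi, forall x, 0 <= phi x <= u x, phi x1 = u x1 &
      h phi <= e].
Proof.
move=> e0; (* Normalising phi(x1) to u(x1) turns energy d phi(x1)^2 into e. *)
pose d := e / u x1 ^+ 2.
have d0 : 0 < d by rewrite divr_gt0// exprn_gt0.
have [phi [fs hphi]] : exists phi, finitely_supported phi /\
    h phi < d * phi x1 ^+ 2.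
  apply: contrapT => H; apply: crit.
  exists (fun x => if x == x1 then d else 0); split.
    split; first by move=> x; case: ifP => // _; exact: ltW.
    by exists x1; rewrite eqxx gt_eqF.
  move=> phi fs; rewrite (_ : tsum _ = d * phi x1 ^+ 2).
    by rewrite leNgt; apply/negP => hl; apply: H; exists phi.
  apply: has_sum_tsum.
  have := @has_sum_fin _ _ (fun x => (if x == x1 then d else 0) * phi x ^+ 2) [:: x1] isT.
  rewrite big_seq1 eqxx; apply => x; rewrite inE => /negbTE ->.
  by rewrite mul0r.
have p0 : phi x1 != 0.
  apply/negP => /eqP p0; move: hphi; rewrite p0 expr0n mulr0.
  by rewrite ltNge h_ge0.
pose c := u x1 / phi x1; pose chi x := c * phi x.
have fchi : finitely_supported chi by exact: finitely_supportedZ.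
have [ft ht] := truncation graph_b u_super conn_b fchi.
exists (fun x => Num.min `|chi x| (u x)); split => //.
- by move=> x; rewrite le_min normr_ge0 ltW//= ge_min lexx orbT.
- by rewrite /chi /c divfK// gtr0_norm// minxx.
apply: (le_trans ht).
rewrite (formZ_sqr (a := schrodinger_form b q) (b := b) (V := vertex_weight b q)) //.
  have -> : e = c ^+ 2 * (d * phi x1 ^+ 2).
    by rewrite /c /d; field; rewrite p0 gt_eqF.
  by rewrite ler_wpM2l ?sqr_ge0// ltW.
exact: schrodinger_form_finite.
Qed.

(** For a null sequence phi_n, the variational expression at s phi_n tends to at
    least 2 s F - mu s^2 W, where F = <f, u>; the choice s = F / (mu W) maximises
    this. *)
Lemma positive_critical_lower mu : 0 < mu ->
  l2inner f u ^+ 2 / (mu * W) <= Q mu.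
Proof.
move=> mu0; have W0 := ground_mass_gt0; have [_ [x1 _]] := w_pos.
have [C C0 hC] := pairing_gap x1 ff.
pose s := l2inner f u / (mu * W).
apply/ler_addgt0Pr => e e0.
have s1 : 0 < 2 * (s ^+ 2 + 1) by rewrite mulr_gt0// ltr_wpDl// sqr_ge0.
have sC : 0 < 16 * (s ^+ 2 * C + 1).
  by rewrite mulr_gt0// ltr_wpDl// mulr_ge0// sqr_ge0.
(* The first bound is for the energy s^2 h(phi) of s phi, the second one for the
   gap 2 s (<f, phi> - F), whose square is at most 4 s^2 C h(phi). *)
pose d := Num.min (e / (2 * (s ^+ 2 + 1))) (e ^+ 2 / (16 * (s ^+ 2 * C + 1))).
have d0 : 0 < d by rewrite lt_min !divr_gt0// exprn_gt0.
have [phi [fs pu p1 hd]] := null_sequence x1 d0.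
have s0 := h_ge0 fs.
have fsz := finitely_supportedZ s fs.
apply: (le_trans _ (lerD (Q_ge mu0 fsz) (lexx e))).
have /finitely_supportedP[K uK kK] := fs.
have WE : Wt (fun x => s * phi x) = s ^+ 2 * Wt phi.
  rewrite (weight_fin _ _ uK); last by move=> x /kK ->; rewrite mulr0.
  rewrite (weight_fin _ _ uK)// mulr_sumr; apply: eq_bigr => x _; ring.
have Wle : Wt phi <= W.
  rewrite (weight_fin _ _ uK)//.
  apply: (@le_trans _ _ (\sum_(x <- K) w x * u x ^+ 2)).
    apply: ler_sum => x _; rewrite -mulrA ler_wpM2l// -expr2.
    have /andP[a1 a2] := pu x; by rewrite ler_pXn2r// nnegrE// ltW.
  by apply: has_sum_ge_partial W_sum uK => x; rewrite mulr_ge0// sqr_ge0.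
have hE : h (fun x => s * phi x) = s ^+ 2 * h phi.
  rewrite (formZ_sqr (a := schrodinger_form b q) (b := b) (V := vertex_weight b q)) //.
  exact: schrodinger_form_finite.
have LE : l2inner f (fun x => s * phi x) = s * l2inner f phi.
  have /finitely_supportedP[L uL kL] := ff.
  by rewrite !(pairing_fin _ uL kL) mulr_sumr; apply: eq_bigr => x _; ring.
rewrite shifted_form_sqr WE hE LE mulNr opprK.
have gap := hC _ fs; rewrite p1 divff ?gt_eqF// mul1r in gap.
set t := l2inner f phi - l2inner f u in gap.
have -> : l2inner f phi = l2inner f u + t by rewrite /t; ring.
have b1 : s ^+ 2 * h phi <= e / 2.
  apply: (@le_trans _ _ ((s ^+ 2 + 1) * (e / (2 * (s ^+ 2 + 1))))).
    rewrite ler_pM ?sqr_ge0// ?lerDl//.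
    by apply: (le_trans hd); rewrite ge_min lexx.
  by rewrite le_eqVlt; apply/orP; left; apply/eqP; field; rewrite gt_eqF//; nra.
have b2 : - (2 * s * t) <= e / 2.
  rewrite -[leLHS](mulrN) -mulrA -[e / 2](addr0).
  have : (2 * s * t) ^+ 2 <= (e / 2) ^+ 2.
    have : s ^+ 2 * C * h phi <= e ^+ 2 / 16.
      apply: (@le_trans _ _ ((s ^+ 2 * C + 1) * (e ^+ 2 / (16 * (s ^+ 2 * C + 1))))).
        apply: ler_pM => //; [exact: mulr_ge0 (sqr_ge0 _) C0|by rewrite lerDl|].
        by apply: (le_trans hd); rewrite ge_min lexx orbT.
      rewrite le_eqVlt; apply/orP; left; apply/eqP; field; rewrite gt_eqF//.
      by rewrite ltr_wpDl// mulr_ge0// sqr_ge0.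
    have : s ^+ 2 * t ^+ 2 <= s ^+ 2 * (C * h phi) by rewrite ler_wpM2l ?sqr_ge0.
    lra.
  move=> hsq; rewrite addr0 leNgt; apply/negP => hlt.
  have : 0 < e / 2 by rewrite divr_gt0.
  nra.
have b3 : mu * (s ^+ 2 * Wt phi) <= mu * (s ^+ 2 * W).
  by rewrite ler_wpM2l ?(ltW mu0)// ler_wpM2l ?sqr_ge0.
have b4 : 2 * s * l2inner f u - mu * (s ^+ 2 * W) = l2inner f u ^+ 2 / (mu * W).
  by rewrite /s; field; rewrite !gt_eqF.
lra.
Qed.

(** Apply the upper bound with theta = rho and a finite set that carries at
    least the fraction rho of the mass W, with rho < 1 close to 1. *)
Lemma positive_critical_limit :
  forall e : R, 0 < e -> exists2 d : R, 0 < d &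
    forall mu : R, 0 < mu -> mu < d -> `|mu * Q mu - l2inner f u ^+ 2 / W| <= e.
Proof.
move=> e e0; have W0 := ground_mass_gt0.
set F := l2inner f u ^+ 2; have F0 : 0 <= F by exact: sqr_ge0.
have F1 : 0 < F + 1 by rewrite ltr_wpDl.
(* With rho = 1 / (1 + de), the factor 1 / rho^2 is at most 1 + 3 de since de <= 1,
   and 3 de F / W <= e / 2. *)
pose de := Num.min 1 (e * W / (6 * (F + 1))).
have de0 : 0 < de by rewrite lt_min ltr01 divr_gt0// mulr_gt0.
have de1 : de <= 1 by rewrite ge_min lexx.
have deF : 3 * de * F <= e / 2 * W.
  have : de * (6 * (F + 1)) <= e * W.
    by rewrite -ler_pdivlMr ?mulr_gt0// ge_min lexx orbT.
  nra.
pose rho := (1 + de)^-1.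
have dep : 0 < 1 + de by rewrite ltr_wpDl// ler01.
have rho0 : 0 < rho by rewrite invr_gt0.
have rho1 : rho < 1 by rewrite invf_lt1// ltrDl.
have [A hA] := W_sum (mulr_gt0 (etrans (subr_gt0 _ _) rho1) W0).
have := hA (undup A) (undup_uniq A) (fun x => ltac:(by rewrite mem_undup)).
set n := \sum_(x <- _) _; rewrite ler_norml => /andP[hn _].
have nW : rho * W <= n by lra.
have n0 : 0 < n by apply: lt_le_trans nW; rewrite mulr_gt0.
have [C [mu0 [m0 hC]]] := variational_upper (undup_uniq A) rho0 rho1 n0.
have C1 : 0 < `|C| + 1 by rewrite ltr_wpDl.
exists (Num.min mu0 (e / 2 / (`|C| + 1))) => [|mu mup].
  by rewrite lt_min m0 !divr_gt0.
rewrite lt_min => /andP[mu1 mu2].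
have lo : F / W <= mu * Q mu.
  have := positive_critical_lower mup; rewrite -(ler_pM2l mup); congr (_ <= _).
  by rewrite -/F; field; rewrite !gt_eqF.
rewrite ger0_norm ?subr_ge0// lerBlDl.
have hQ := ler_wpM2l (ltW mup) (Q_le mup (fun phi fs => hC mu phi mup mu1 fs)).
apply: (le_trans hQ); rewrite mulrDr.
have c1 : mu * C <= e / 2.
  apply: (@le_trans _ _ (mu * (`|C| + 1))).
    by rewrite ler_wpM2l ?(ltW mup)// (le_trans (ler_norm _))// lerDl.
  by rewrite -ler_pdivlMr// ltW.
have c2 : mu * (F / (mu * rho * n)) <= F / W + e / 2.
  apply: (@le_trans _ _ (F / (rho * (rho * W)))).
    rewrite (_ : mu * (F / (mu * rho * n)) = F / (rho * n)); last by field; rewrite !gt_eqF.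
    apply: ler_wpM2l => //.
    rewrite lef_pV2 ?posrE; [|by rewrite mulr_gt0|by rewrite !mulr_gt0].
    by rewrite ler_wpM2l// ltW.
  have -> : F / (rho * (rho * W)) = (1 + de) ^+ 2 * F / W.
    by rewrite /rho; field; rewrite !gt_eqF.
  rewrite -[leRHS](mulfK (lt0r_neq0 W0)).
  rewrite ler_wpM2r ?invr_ge0 ?(ltW W0)// mulrDl divfK ?gt_eqF//.
  have h1 : de * (de * F) <= de * F by rewrite ler_piMl// mulr_ge0// ltW.
  rewrite (_ : (1 + de) ^+ 2 * F = F + 2 * (de * F) + de * (de * F)); last by ring.
  move: deF; rewrite -mulrA; lra.
by apply: (le_trans (lerD c2 c1)); lra.
Qed.

End positive_critical_case.

End limits.

(** * The limit of the Green function *)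

Section conclusion.
Variables (R : realType) (X : choiceType) (b : X -> X -> R) (q : X -> R).
Hypothesis graph_b : is_graph b.

Lemma positive_supersolutionZ (c : R) (u : X -> R) : 0 < c ->
  positive_supersolution b q u -> positive_supersolution b q (fun x => c * u x).
Proof.
move=> c0 [dom [u0 [x1 ux1]] Hu].
have domc : formal_domain b (fun x => c * u x).
  move=> x; have s := abs_summable_has_sum (dom x).
  apply: (has_sum_abs_summable (s := c * tsum (fun y => b x y * `|u y|))).
  by apply: eq_has_sum (has_sumZ c s) => y; rewrite normrM gtr0_norm//; ring.
split => //.
  split; first by move=> x; rewrite mulr_ge0// ltW.
  by exists x1; rewrite mulf_neq0// gt_eqF.
move=> x; have -> : schrodinger b q (fun x => c * u x) x = c * schrodinger b q u x.
  rewrite (schrodingerE q graph_b x dom) (schrodingerE q graph_b x domc) mulrBr.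
  congr (_ - _); first by ring.
  apply: has_sum_tsum.
  apply: eq_has_sum (has_sumZ c (formal_domain_has_sum x dom)) => y; ring.
by rewrite mulr_ge0// ltW.
Qed.

Variable G : R -> X -> X -> \bar R.
Variable Q : R -> (X -> R) -> R.
Hypothesis GE : forall l : R, l < 0 -> forall x x0, G l x x0 = (4^-1 *
      (Q l (fun y => \1_[set x0] y + \1_[set x] y)
       - Q l (fun y => \1_[set x0] y - \1_[set x] y)))%:E.

(** The polarisation identity carries the limits of mu Q to those of mu G. *)
Lemma green_limit (phi : X -> R) :
  (forall f, finitely_supported f -> forall e : R, 0 < e ->
    exists2 d : R, 0 < d & forall mu : R, 0 < mu -> mu < d ->
      `|mu * Q (- mu) f - l2inner f phi ^+ 2| <= e) ->
  forall x x0 : X,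
    ((- l)%:E * G l x x0)%E @[l --> (0 : R)^'-] --> (phi x * phi x0)%:E.
Proof.
move=> hQ x x0; pose fp y : R := \1_[set x0] y + \1_[set x] y.
pose fm y : R := \1_[set x0] y - \1_[set x] y.
have dx := finitely_supported_indic1 R x; have dx0 := finitely_supported_indic1 R x0.
have fps : finitely_supported fp.
  have := finitely_supported_lin 1 dx0 dx; congr finitely_supported.
  by apply/funext => z; rewrite mul1r.
have fms : finitely_supported fm by exact: finitely_supportedB.
have hval (c : R) : l2inner (fun y => \1_[set x0] y + c * \1_[set x] y) phi =
    phi x0 + c * phi x.
  have e1 (z : X) : has_sum (fun y => \1_[set z] y * phi y) (phi z).
    have := @has_sum_fin _ _ (fun y => \1_[set z] y * phi y) [:: z] isT.
    rewrite big_seq1 indicE in_set1 eqxx mul1r; apply => y.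
    by rewrite inE indicE in_set1 => /negbTE ->; rewrite mul0r.
  apply: has_sum_tsum; apply: eq_has_sum (has_sumD (e1 x0) (has_sumZ c (e1 x))).
  by move=> y; ring.
have vp : l2inner fp phi = phi x0 + phi x.
  have -> : fp = fun y => \1_[set x0] y + 1 * \1_[set x] y.
    by apply/funext => y; rewrite (mul1r (\1_[set x] y : R)).
  by rewrite hval mul1r.
have vm : l2inner fm phi = phi x0 - phi x.
  have -> : fm = fun y => \1_[set x0] y + (-1) * \1_[set x] y.
    by apply/funext => y; rewrite (mulN1r (\1_[set x] y : R)).
  by rewrite hval mulN1r.
apply/fine_cvgP; split.
  exists 1 => //= l _ l0; by rewrite GE// -EFinM.
apply/cvgrPdist_le => e e0.
have [d1 d10 h1] := hQ _ fps _ e0; have [d2 d20 h2] := hQ _ fms _ e0.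
exists (Num.min d1 d2) => /=; first by rewrite lt_min d10.
move=> l /=; rewrite sub0r normrN lt_min => /andP[l1 l2] l0.
rewrite GE//= -/fp -/fm.
have ml : 0 < - l by rewrite oppr_gt0.
rewrite ltr0_norm// in l1 l2.
have := h1 _ ml l1; have := h2 _ ml l2; rewrite !opprK vp vm !ler_norml.
move=> /andP[a1 a2] /andP[a3 a4]; apply/andP; split; nra.
Qed.

End conclusion.

Theorem theorem6p4 (R : realType) (X : choiceType)
    (infX : infinite_set [set: X])
    (b : X -> X -> R) (q : X -> R)
    (graph_b : is_graph b) (conn_b : graph_connected b)
    (H_ge0 : schrodinger_ge0 b q)
    (w : X -> R) (w_pos : positive_fun w)
    (G : R -> X -> X -> \bar R)
    (GreenG : forall lambda : R, lambda < 0 ->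
       is_green (shifted_form b q w lambda) (G lambda)) :
  exists phi : X -> R,
    [/\ forall x x0 : X,
          ((- lambda)%:E * G lambda x x0)%E @[lambda --> (0 : R)^'-]
            --> (phi x * phi x0)%:E,
        ~ positive_critical b q w -> forall x, phi x = 0
      & positive_critical b q w ->
          ground_state b q phi /\
          \esum_(x in [set: X]) (phi x ^+ 2 * w x)%:E = 1%E].
Proof.
have [u u_super] := H_ge0.
have w0 x : 0 <= w x by case: w_pos.
have /choice[Q hQ] : forall l : R, exists Q : (X -> R) -> R, l < 0 -> [/\
    forall f (M : R), finitely_supported f ->
      (forall phi, finitely_supported phi ->
         2 * l2inner f phi - shifted_form b q w l phi phi <= M) -> Q f <= M,
    forall f phi, finitely_supported f -> finitely_supported phi ->
      2 * l2inner f phi - shifted_form b q w l phi phi <= Q f &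
    forall x x0, G l x x0 = (4^-1 *
      (Q (fun y => \1_[set x0] y + \1_[set x] y)
       - Q (fun y => \1_[set x0] y - \1_[set x] y)))%:E].
  move=> l; have [l0|l0] := ltP l 0; last by exists (fun=> 0).
  have [Q hQ] := green_variational graph_b
    (fun K phi psi => @shifted_form_finite _ _ b q graph_b w l K phi psi)
    (fun phi => shifted_form_ge0 graph_b conn_b w_pos u_super l0)
    (fun f => shifted_form_coercive graph_b conn_b w_pos u_super l0)
    (GreenG l l0).
  by exists Q.
have Nneg (mu : R) : 0 < mu -> - mu < 0 by rewrite oppr_lt0.
have GE l : l < 0 -> _ := fun l0 => let: And3 _ _ h := hQ l l0 in h.
have Q_le f (ff : finitely_supported f) (mu M : R) : 0 < mu ->
  (forall phi, finitely_supported phi ->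
    2 * l2inner f phi - shifted_form b q w (- mu) phi phi <= M) -> Q (- mu) f <= M.
  by move=> /Nneg/hQ[h _ _]; exact: h.
have Q_ge f (ff : finitely_supported f) (mu : R) phi : 0 < mu ->
  finitely_supported phi ->
  2 * l2inner f phi - shifted_form b q w (- mu) phi phi <= Q (- mu) f.
  by move=> /Nneg/hQ[_ h _]; exact: h.
have inner0 f : l2inner f (fun=> 0) = 0.
  by rewrite (l2inner_fin (K := [::]))// big_nil.
have zero : (forall f, finitely_supported f -> forall e : R, 0 < e ->
      exists2 d : R, 0 < d & forall mu : R, 0 < mu -> mu < d ->
        `|mu * Q (- mu) f - 0| <= e) ->
    forall x x0 : X, ((- lambda)%:E * G lambda x x0)%E @[lambda --> (0 : R)^'-]
            --> ((fun=> 0 : R) x * (fun=> 0 : R) x0)%:E.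
  move=> h; apply: (green_limit GE (phi := fun=> 0)) => f ff e e0.
  by have := h f ff e e0; rewrite inner0 expr0n.
have [sub|nsub] := pselect (subcritical b q).
  exists (fun=> 0); split => //.
    apply: zero => f ff.
    exact: (subcritical_limit graph_b conn_b w_pos u_super ff
      (Q := fun mu => Q (- mu) f) (Q_le f ff) (Q_ge f ff) sub).
  by move=> [psi [[[_ ns] _] _]].
have [[psi [[_ psi_super] psi_fin]]|npc] := pselect (positive_critical b q w).
  have [W W_sum] : exists W, has_sum (fun x => w x * psi x ^+ 2) W.
    have := ge0_has_sum _ psi_fin.
    move=> H; eexists; apply: eq_has_sum (H _) => x; first by rewrite mulrC.
    by rewrite mulr_ge0// sqr_ge0.
  have W0 := ground_mass_gt0 graph_b conn_b w_pos psi_super W_sum.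
  pose c := (Num.sqrt W)^-1.
  have c0 : 0 < c by rewrite invr_gt0 sqrtr_gt0.
  have c2 : c ^+ 2 = W^-1 by rewrite exprVn sqr_sqrtr// ltW.
  exists (fun x => c * psi x); split.
  - apply: (green_limit GE (phi := fun x => c * psi x)) => f ff e e0.
    have -> : l2inner f (fun x => c * psi x) ^+ 2 = l2inner f psi ^+ 2 / W.
      have /finitely_supportedP[K uK kK] := ff.
      rewrite -c2 -exprMn; congr (_ ^+ 2).
      rewrite !(pairing_fin _ uK kK) mulr_suml; apply: eq_bigr => x _; ring.
    exact: (positive_critical_limit graph_b conn_b w_pos psi_super ff
      (Q := fun mu => Q (- mu) f) (Q_le f ff) (Q_ge f ff) nsub W_sum).
  - by move=> h; exfalso; apply: h; exists psi.
  move=> _; split.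
    by split; [split|exact: positive_supersolutionZ].
  rewrite (has_sum_esum (s := 1))// => [x|].
    by rewrite mulr_ge0// sqr_ge0.
  have := has_sumZ (c ^+ 2) W_sum.
  rewrite {2}c2 mulVf ?gt_eqF//; apply: eq_has_sum => x; ring.
exists (fun=> 0); split => //.
apply: zero => f ff.
apply: (null_critical_limit graph_b conn_b w_pos u_super ff
  (Q := fun mu => Q (- mu) f) (Q_le f ff) (Q_ge f ff)) => fin.
by apply: npc; exists u.
Qed.
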